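(* Consider any radius $r$ such that $r\ge \sqrt{L_n(f^\dagger,\hat f)}$, and let $\rho>0$ be a noise scale for which $\sqrt{L_n(\hat f,f^\diamond_\rho)}=3(\beta/\alpha)^{1/2}r$. Then for any $0<\delta<1$, with probability at least $1-8\delta$, $$|\mathrm{Opt}^*(\hat f)|\le |\widetilde{\mathrm{Opt}}^{\diamond}(f^\diamond_\rho)|+A_n(\hat f)+\Big[\sqrt{L_n(f^*,f^\dagger)}+5r\Big]\cdot\frac{2\|w\|_\infty(\beta^{3/2}\vee\beta^2)\sqrt{\log(1/\delta)}}{(\alpha^{3/2}\wedge\alpha)\sqrt n}.$$ Consequently, with probability at least $1-8\delta$, the excess risk satisfies $$\mathcal E_{fix}(\hat f)\le \frac1n\sum_{i=1}^n\ell(y_i,\hat f(x_i))+\left\{|\widetilde{\mathrm{Opt}}^{\diamond}(f^\diamond_\rho)|+A_n(\hat f)+\Big[\sqrt{L_n(f^*,f^\dagger)}+5r\Big]\cdot\frac{2\|w\|_\infty(\beta^{3/2}\vee\beta^2)\sqrt{\log(1/\delta)}}{(\alpha^{3/2}\wedge\alpha)\sqrt n}\right\}.$$ Here the pilot error is $$A_n(\hat f):=\sup_{f\in\mathcal B_{3r(\beta/\alpha)^{1/2}}(\hat f)}\frac1n\sum_{i=1}^n\ell_1'(\hat f(x_i),f(x_i))\,\varepsilon_i\,(\hat f(x_i)-f^*(x_i)).$$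
   Context: Loss. $\phi:\mathbb R\to\mathbb R$ is differentiable, $\alpha$-strongly convex ($\phi(y)\ge\phi(x)+\phi'(x)(y-x)+\frac{\alpha}{2}(y-x)^2$) and $\beta$-smooth ($\phi'$ is $\beta$-Lipschitz), $0<\alpha\le\beta$. The loss is the Bregman divergence $\ell(x,y)=D_\phi(x,y)=\phi(x)-\phi(y)-\phi'(y)(x-y)$, and $\ell_1'(x,y)=\phi'(x)-\phi'(y)$ is its derivative in the first variable. Data (fixed design). $x_1,\dots,x_n\in\mathcal X$ are fixed; $y_1,\dots,y_n$ are independent real responses, $y_i\sim\mathbb P(\cdot\mid x_i)$, $f^*(x_i)=\mathbb E[y_i]$ (the minimizer of $\frac1n\sum_i\mathbb E[\ell(y_i,f(x_i))]$), and $y_i=f^*(x_i)+w_i$, where the $w_i$ are independent, mean zero, with symmetric distributions (not necessarily identical). $\|w\|_\infty=\max_i|w_i|$. Training procedure. $\mathcal F$ is a class of functions from $\mathcal X$ to $\mathcal Y\subset\mathbb R$; $\mathcal C\subset\mathbb R$ is a compact set; $\mathcal R(f)=0$ if $f(x_i)\in\mathcal C$ for all $i$ and $\mathcal R(f)=\infty$ otherwise. The procedure $\mathcal A$ maps a dataset $\{(x_i,z_i)\}_{i=1}^n$ to a minimizer over $f\in\mathcal F$ of $\frac1n\sum_{i=1}^n\ell(z_i,f(x_i))+\mathcal R(f)$. Put $\hat f=\mathcal A(\{(x_i,y_i)\})$ and $f^\dagger=\mathcal A(\{(x_i,f^*(x_i))\})$. Distances. $L_n(f_1,f_2)=\frac1n\sum_{i=1}^n\ell(f_1(x_i),f_2(x_i))$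 and $\mathcal B_r(g)=\{f\in\mathcal F:\sqrt{L_n(g,f)}\le r\}$. Excess risk. $\mathcal E_{fix}(\hat f)=\mathbb E_{y'_{1:n}}\big[\frac1n\sum_i\ell(y'_i,\hat f(x_i))-\frac1n\sum_i\ell(y'_i,f^*(x_i))\big]$, where $y'_i\sim\mathbb P(\cdot\mid x_i)$ are fresh responses independent of the training data; it equals $L_n(f^*,\hat f)$. Wild refitting. $\tilde w_i=y_i-\hat f(x_i)$; $\varepsilon_1,\dots,\varepsilon_n$ are i.i.d. Rademacher signs independent of the data; for $\rho>0$ the wild response $y_i^\diamond$ is defined by $\phi'(y_i^\diamond)=\phi'(\hat f(x_i))-\rho\,\varepsilon_i\tilde w_i$; and $f^\diamond_\rho=\mathcal A(\{(x_i,y_i^\diamond)\}_{i=1}^n)$. True optimism: $\mathrm{Opt}^*(\hat f)=\frac1n\sum_{i=1}^n\ell_1'(f^*(x_i),\hat f(x_i))\,w_i$. Wild optimism: $\widetilde{\mathrm{Opt}}^\diamond(f^\diamond_\rho)=\frac{\beta}{\rho n}\sum_{i=1}^n\ell(\hat f(x_i),f^\diamond_\rho(x_i))+\frac{\beta}{\rho n}\sum_{i=1}^n\ell(\hat f(x_i),y_i^\diamond)-\frac{\alpha^2}{\beta\rho n}\sum_{i=1}^n\ell(y_i^\diamond,f^\diamond_\rho(x_i))$. Probability is over the noise $w$ and the signs $\varepsilon$. $a\vee b$, $a\wedge b$ denote max and min. *)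

(* Defs.v *)
From HB Require Import structures.
From mathcomp Require Import all_boot all_order all_algebra.
From mathcomp Require Import all_classical all_reals all_analysis.

Set Implicit Arguments.
Unset Strict Implicit.
Unset Printing Implicit Defensive.

Import Order.TTheory GRing.Theory Num.Theory.
Import numFieldNormedType.Exports.

Local Open Scope classical_set_scope.
Local Open Scope ring_scope.

Definition mean (R : realType) (n : nat) (a : 'I_n -> R) : R :=
  n%:R^-1 * \sum_(i < n) a i.

Definition strongly_convex (R : realType) (alpha : R) (phi : R -> R) : Prop :=
  forall s t : R,
    phi s + derive1 phi s * (t - s) + alpha / 2 * (t - s) ^+ 2 <= phi t.

Definition smooth (R : realType) (beta : R) (phi : R -> R) : Prop :=
  forall s t : R, `|derive1 phi s - derive1 phi t| <= beta * `|s - t|.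

Definition loss (R : realType) (phi : R -> R) (s t : R) : R :=
  phi s - phi t - derive1 phi t * (s - t).

Definition dloss (R : realType) (phi : R -> R) (s t : R) : R :=
  derive1 phi s - derive1 phi t.

Definition Ln (R : realType) (X : Type) (n : nat) (phi : R -> R)
    (x : 'I_n -> X) (f g : X -> R) : R :=
  mean (fun i => loss phi (f (x i)) (g (x i))).

Definition Lball (R : realType) (X : Type) (n : nat) (phi : R -> R)
    (x : 'I_n -> X) (F : set (X -> R)) (r : R) (g : X -> R) : set (X -> R) :=
  [set f | F f /\ Num.sqrt (Ln phi x g f) <= r].

Definition dataset (R : realType) (X : Type) (n : nat) (x : 'I_n -> X)
    (z : 'I_n -> R) : 'I_n -> X * R :=
  fun i => (x i, z i).

Definition penalty (R : realType) (X : Type) (n : nat) (x : 'I_n -> X)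
    (C : set R) (f : X -> R) : \bar R :=
  if `[< forall i, C (f (x i)) >] then 0%E else +oo%E.

Definition objective (R : realType) (X : Type) (n : nat) (phi : R -> R)
    (x : 'I_n -> X) (C : set R) (z : 'I_n -> R) (f : X -> R) : \bar R :=
  ((mean (fun i => loss phi (z i) (f (x i))))%:E + penalty x C f)%E.

Definition is_training_procedure (R : realType) (X : Type) (n : nat)
    (phi : R -> R) (x : 'I_n -> X) (F : set (X -> R)) (C : set R)
    (A : ('I_n -> X * R) -> X -> R) : Prop :=
  forall z : 'I_n -> R,
    F (A (dataset x z)) /\
    forall f, F f ->
      (objective phi x C z (A (dataset x z)) <= objective phi x C z f)%E.

(* Borel measurability of the fitted values as functions of the responses:
   this is what makes the fit a random element. *)
Definition measurable_procedure (R : realType) (X : Type) (n : nat)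
    (x : 'I_n -> X) (A : ('I_n -> X * R) -> X -> R) : Prop :=
  forall i : 'I_n,
    measurable_fun [set: n.-tuple R]
      (fun z : n.-tuple R => A (dataset x (tnth z)) (x i)).

Definition mutually_independent (d : measure_display) (T : measurableType d)
    (R : realType) (P : probability T R) (I : finType)
    (Z : I -> {RV P >-> R}) : Prop :=
  forall (J : {set I}) (B : I -> set R), (forall i, measurable (B i)) ->
    P (\bigcap_(i in [set` J]) Z i @^-1` B i) =
    (\prod_(i in J) P (Z i @^-1` B i))%E.

Definition symmetric_law (d : measure_display) (T : measurableType d)
    (R : realType) (P : probability T R) (w : T -> R) : Prop :=
  forall B : set R, measurable B ->
    P (w @^-1` B) = P ((fun omega => - w omega) @^-1` B).

Definition rademacher (d : measure_display) (T : measurableType d)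
    (R : realType) (P : probability T R) (e : T -> R) : Prop :=
  P (e @^-1` [set 1]) = (2^-1 : R)%:E /\ P (e @^-1` [set -1]) = (2^-1 : R)%:E.

(* The responses and the signs as one family: its mutual independence says that
   the responses are independent, the signs are independent, and the signs are
   independent of the responses. *)
Definition join_families (S : Type) (n : nat) (y e : 'I_n -> S) :
    'I_n + 'I_n -> S :=
  fun k => match k with inl i => y i | inr i => e i end.

(* "With probability at least p, Q holds".  The set Q may fail to be measurable
   (it involves a supremum over an arbitrary class of functions), so Q is
   required to contain an event of probability at least p. *)
Definition with_probability_at_least (d : measure_display)
    (T : measurableType d) (R : realType) (P : probability T R) (p : R)
    (Q : set T) : Prop :=
  exists E : set T, [/\ measurable E, (p%:E <= P E)%E & E `<=` Q].

(* Expectation over fresh responses y', the predictor f being held fixed. *)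
Definition excess_risk (d : measure_display) (T : measurableType d)
    (R : realType) (P : probability T R) (X : Type) (n : nat) (phi : R -> R)
    (x : 'I_n -> X) (y' : 'I_n -> {RV P >-> R}) (fstar f : X -> R) : \bar R :=
  'E_P[(fun omega => mean (fun i => loss phi (y' i omega) (f (x i)))
                   - mean (fun i => loss phi (y' i omega) (fstar (x i))))%R]%E.

Definition sup_norm (R : realType) (n : nat) (w : 'I_n -> R) : R :=
  \big[Num.max/0]_(i < n) `|w i|.

(* The choice made by [xget] is immaterial: the derivative of a differentiable,
   strongly convex and smooth phi is a bijection of the reals. *)
Definition wild_response (R : realType) (X : Type) (n : nat) (phi : R -> R)
    (x : 'I_n -> X) (fhat : X -> R) (y e : 'I_n -> R) (rho : R) : 'I_n -> R :=
  fun i => xget 0 [set t : R |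
    derive1 phi t = derive1 phi (fhat (x i)) - rho * e i * (y i - fhat (x i))].

Definition true_optimism (R : realType) (X : Type) (n : nat) (phi : R -> R)
    (x : 'I_n -> X) (fstar fhat : X -> R) (w : 'I_n -> R) : R :=
  mean (fun i => dloss phi (fstar (x i)) (fhat (x i)) * w i).

Definition wild_optimism (R : realType) (X : Type) (n : nat) (phi : R -> R)
    (alpha beta rho : R) (x : 'I_n -> X) (fhat fdia : X -> R)
    (ydia : 'I_n -> R) : R :=
    beta / (rho * n%:R) * \sum_(i < n) loss phi (fhat (x i)) (fdia (x i))
  + beta / (rho * n%:R) * \sum_(i < n) loss phi (fhat (x i)) (ydia i)
  - alpha ^+ 2 / (beta * rho * n%:R) *
      \sum_(i < n) loss phi (ydia i) (fdia (x i)).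

(* A genuine supremum when r >= 0, alpha > 0 and F contains fhat: the set
   contains 0, and it is bounded since the values f (x i) stay bounded over the
   ball. *)
Definition pilot_error (R : realType) (X : Type) (n : nat) (phi : R -> R)
    (alpha beta r : R) (x : 'I_n -> X) (F : set (X -> R))
    (fstar fhat : X -> R) (e : 'I_n -> R) : R :=
  sup [set mean (fun i => dloss phi (fhat (x i)) (f (x i)) * e i
                          * (fhat (x i) - fstar (x i)))
      | f in Lball phi x F (3 * r * Num.sqrt (beta / alpha)) fhat].

Definition deviation (R : realType) (X : Type) (n : nat) (phi : R -> R)
    (alpha beta r delta : R) (x : 'I_n -> X) (fstar fdag : X -> R)
    (w : 'I_n -> R) : R :=
  (Num.sqrt (Ln phi x fstar fdag) + 5 * r) *
  (2 * sup_norm w * Num.max (beta `^ (3 / 2)) (beta ^+ 2)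
     * Num.sqrt (ln delta^-1)
   / (Num.min (alpha `^ (3 / 2)) alpha * Num.sqrt n%:R)).

(* Main.v *)
(* Write w for the noise, c(f) = phi'(fdag) - phi'(f), and let Z(p) be the
   supremum of <c(f), p> over the feasible f with L_n(fdag, f) <= r^2.  Since
   phi'(fstar) - phi'(fhat) = (phi'(fstar) - phi'(fdag)) + c(fhat), the true
   optimism is at most a fixed linear form in w (Hoeffding) plus Z(w) or Z(-w).
   Given |w| and |eps|, the sign vectors of w and of eps w are independent and
   uniform, so Z(w) and Z(eps w) are independent copies of a supremum of
   Rademacher sums, and Maurey's infimum-convolution inequality on the cube bounds
   the Laplace transform of their difference; the same holds for Z(-w).  Next,
   <c(f), eps w> = <c(fhat), eps w> + <phi'(fhat) - phi'(f), eps (y - fhat)>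
                   + <phi'(fhat) - phi'(f), eps (fhat - fstar)>:
   the first term is small by Hoeffding in eps, as fhat depends on w only; the
   third one is the pilot error; and by polarization, phi'(fhat) - phi'(ydia)
   being rho eps (y - fhat), the second one is at most the wild optimism, because
   fdia minimizes the loss at ydia.  Finally, the excess risk is L_n(fstar, fhat),
   which is the training error minus the true optimism minus a nonnegative term.

   No conditioning is needed: the joint law of (w, eps) is invariant under sign
   flips of the coordinates, hence an event has probability at most delta as soon
   as, for every fixed point, at most a fraction delta of the flips sends the
   point into it. *)
Require Import Defs.
From HB Require Import structures.
From mathcomp Require Import all_boot all_order all_algebra.
From mathcomp Require Import all_classical all_reals all_analysis.
From mathcomp Require Import measurable_realfun ring lra.

Set Implicit Arguments.
Unset Strict Implicit.
Unset Printing Implicit Defensive.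

Import Order.TTheory GRing.Theory Num.Theory.
Import numFieldNormedType.Exports.

Local Open Scope classical_set_scope.
Local Open Scope ring_scope.

(** * Rademacher sums on the discrete cube *)

Lemma expRN_le (R : realType) (t : R) : 0 <= t -> expR (- t) <= (1 + t)^-1.
Proof.
move=> t0; rewrite expRN lef_pV2 ?expR_ge1Dx ?posrE ?expR_gt0//.
by rewrite ltr_wpDr.
Qed.

(* With [u] the ratio of the two conditional Laplace transforms, this is the
   induction step of [maurey]. *)
Lemma two_point (R : realType) (u : R) : 0 < u -> u <= 1 ->
  exists theta : R, [/\ 0 <= theta, theta <= 1 &
    expR (theta ^+ 2 / 8 + theta * ln u) * (1 + u) <= u * (3 - u)].
Proof.
move=> u0 u1; have [u34|u34] := leP (3 / 4) u.
(* The exponent is minimal at [theta = - 4 * ln u]. Its first-order value [4 * (1 - u)] stays below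
   1 on this range of [u] and makes the exponent at most [- 2 * (1 - u) ^+ 2]. *)
- exists (4 * (1 - u)); split; [lra|lra|].
  have lnu : ln u <= u - 1.
    by have := @le_ln1Dx _ (u - 1); rewrite addrCA subrr addr0; apply; lra.
  set v := 2 * (1 - u) ^+ 2.
  have v0 : 0 <= v by rewrite mulr_ge0// sqr_ge0.
  have le_exp : expR ((4 * (1 - u)) ^+ 2 / 8 + 4 * (1 - u) * ln u) <= (1 + v)^-1.
    apply: le_trans (expRN_le v0); rewrite ler_expR /v.
    have : 4 * (1 - u) * ln u <= 4 * (1 - u) * (u - 1) by rewrite ler_wpM2l//; lra.
    nra.
  apply: (@le_trans _ _ ((1 + v)^-1 * (1 + u))); first by rewrite ler_wpM2r//; lra.
  rewrite mulrC ler_pdivrMr; last lra.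
  rewrite -subr_ge0 (_ : _ - _ = (1 - u) ^+ 2 * (6 * u - 2 * u ^+ 2 - 1)); last first.
    by rewrite /v; ring.
  by rewrite mulr_ge0 ?sqr_ge0//; nra.
(* Below [3 / 4] the constraint [theta <= 1] caps the choice, and [expR (1 / 8) <= 8 / 7] leaves
   enough room. *)
exists 1; split; [lra|lra|].
rewrite mul1r expr1n expRD lnK ?posrE//.
have e8 : expR (1 / 8) <= 8 / 7 :> R.
  have := expR_ge1Dx (- (1 / 8) : R); rewrite expRN => h.
  rewrite -[8 / 7]invrK -[expR _]invrK lef_pV2 ?posrE ?invr_gt0 ?expR_gt0//; lra.
have : expR (1 / 8) * (u * (1 + u)) <= 8 / 7 * (u * (1 + u)).
  by rewrite ler_wpM2r// mulr_ge0//; lra.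
nra.
Qed.

Lemma is_derive_ge0_le (R : realType) (f df : R -> R) (t : R) :
  (forall x : R, is_derive x 1 f (df x)) -> (forall x, 0 <= x -> 0 <= df x) ->
  0 <= t -> f 0 <= f t.
Proof.
move=> fdf df0 t0.
have cf : {within `[0, t], continuous f}.
  apply: continuous_subspaceT => x.
  by apply: differentiable_continuous; apply/derivable1_diffP; case: (fdf x).
have [c /itvP ct] := MVT_segment t0 (fun x _ => fdf x) cf.
by rewrite -(subr_ge0 (f 0)) => ->; rewrite mulr_ge0 ?df0 ?subr_ge0 ?ct.
Qed.

(** By parity, [0 <= t] may be assumed. There [g] is nondecreasing: its derivative has the sign of
    [k], which vanishes at 0 and has derivative [x * (expR x - expR (- x))]. *)
Lemma cosh_le (R : realType) (t : R) : expR t + expR (- t) <= 2 * expR (t ^+ 2 / 2).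
Proof.
wlog t0 : t / 0 <= t.
  move=> H; have [/H//|t0] := leP 0 t.
  by have := H (- t); rewrite opprK sqrrN addrC; apply; lra.
pose k : R -> R := (cst 1 + id) * (expR \o -%R) - (cst 1 - id) * expR.
pose q : R -> R := - (2^-1 *: (id ^+ 2)).
pose g : R -> R := - ((expR + (expR \o -%R)) * (expR \o q)).
have dk (x : R) : is_derive x 1 k (x * (expR x - expR (- x))).
  by apply: is_derive_eq; rewrite /GRing.scale /= /cst !fctE; ring.
have dq (x : R) : is_derive x 1 q (- x).
  by apply: is_derive_eq; rewrite /GRing.scale /= expr1; field.
have dg (x : R) : is_derive x 1 g (k x * expR (q x)).
  apply: is_derive_eq; rewrite /GRing.scale /= /k !fctE /cst /=. ring.
have k0 x : 0 <= x -> 0 <= k x.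
  move=> x0; have := is_derive_ge0_le dk _ x0.
  rewrite {1}/k !fctE /= /cst oppr0 expR0 !(addr0, subr0) subrr; apply=> z z0.
  by rewrite mulr_ge0// subr_ge0 ler_expR; lra.
have := is_derive_ge0_le dg _ t0.
have qE x : q x = - (x ^+ 2 / 2) by rewrite /q !fctE /GRing.scale /= mulrC.
rewrite /g !fctE /= !qE expr0n /= mul0r !oppr0 expR0 => /(_ _)/wrap[].
  by move=> x x0; rewrite mulr_ge0 ?k0// expR_ge0.
by rewrite lerN2 mulr1 (expRN (t ^+ 2 / 2)) ler_pdivrMr ?expR_gt0.
Qed.

(** * Maurey's inequality on the cube, by splitting off the first sign *)

Definition signed_sum (R : realType) (n : nat) (c : 'I_n -> R)
    (s : {ffun 'I_n -> bool}) : R :=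
  \sum_(i < n) c i * (-1) ^+ s i.

Definition ffun_cons (n : nat) (p : bool * {ffun 'I_n -> bool}) :
    {ffun 'I_n.+1 -> bool} :=
  [ffun i => if unlift ord0 i is Some j then p.2 j else p.1].

Lemma sum_ffun_cons (R : realType) (n : nat) (G : {ffun 'I_n.+1 -> bool} -> R) :
  \sum_s G s = \sum_s G (ffun_cons (false, s)) + \sum_s G (ffun_cons (true, s)).
Proof.
rewrite (reindex (@ffun_cons n)) /=; last first.
  exists (fun s => (s ord0, [ffun j => s (lift ord0 j)])) => [[b s] _|s _] /=.
    congr pair; first by rewrite ffunE unlift_none.
    by apply/ffunP => j; rewrite !ffunE liftK.
  apply/ffunP => i; rewrite ffunE; case: unliftP => [j ->|->] //=.
  by rewrite ffunE.
rewrite -(pair_bigA _ (fun b s => G (ffun_cons (b, s)))) /= big_bool addrC.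
by [].
Qed.

Lemma signed_sum_cons (R : realType) (n : nat) (c : 'I_n.+1 -> R) b s :
  signed_sum c (ffun_cons (b, s)) =
  (-1) ^+ b * c ord0 + signed_sum (c \o lift ord0) s.
Proof.
rewrite /signed_sum big_ord_recl ffunE unlift_none mulrC; congr (_ + _).
by apply: eq_bigr => i _; rewrite ffunE liftK.
Qed.

(** Hölder's inequality with exponents [1 / (1 - theta)] and [1 / theta], in a logarithmic form that
    includes both endpoints. Dividing each exponential by its sum reduces it to the convexity of
    [expR], obtained from the tangent line at the barycentre [m]. *)
Lemma hoelder_expR (R : realType) (T : finType) (p q : T -> R) (theta : R) :
  (0 < #|T|)%N -> 0 <= theta -> theta <= 1 ->
  \sum_s expR ((1 - theta) * p s + theta * q s) <=
  expR ((1 - theta) * ln (\sum_s expR (p s)) + theta * ln (\sum_s expR (q s))).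
Proof.
move=> T0 t0 t1.
have [x0 _] : exists x : T, x \in T by apply/card_gt0P.
have sum_gt0 (f : T -> R) : 0 < \sum_s expR (f s).
  rewrite (bigD1 x0)//= ltr_pwDl ?expR_gt0//.
  by apply: sumr_ge0 => *; exact: expR_ge0.
set a := ln _; set b := ln _.
have aE : expR a = \sum_s expR (p s) by rewrite lnK// posrE.
have bE : expR b = \sum_s expR (q s) by rewrite lnK// posrE.
clearbody a b.
have conv x y : expR ((1 - theta) * x + theta * y) <=
    (1 - theta) * expR x + theta * expR y :> R.
  set m := _ + _.
  have tgt z : expR m * (1 + (z - m)) <= expR z.
    have -> : expR z = expR m * expR (z - m) by rewrite -expRD addrC subrK.
    by rewrite ler_wpM2l ?expR_ge0 ?expR_ge1Dx.
  have -> : expR m = (1 - theta) * (expR m * (1 + (x - m)))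
                     + theta * (expR m * (1 + (y - m))) by rewrite /m; ring.
  by rewrite lerD// ler_wpM2l// subr_ge0.
set m := (1 - theta) * a + theta * b.
rewrite -[leRHS]mulr1 -ler_pdivrMl ?expR_gt0// -expRN mulr_sumr.
apply: (@le_trans _ _ (\sum_s ((1 - theta) * (expR (p s) / expR a)
                              + theta * (expR (q s) / expR b)))).
  apply: ler_sum => s _; rewrite -!expRN -!expRD.
  apply: le_trans (conv _ _); rewrite ler_expR /m le_eqVlt; apply/orP; left.
  by apply/eqP; ring.
rewrite big_split /= -!mulr_sumr -!mulr_suml -aE -bE !divff ?gt_eqF ?expR_gt0//.
by lra.
Qed.

Lemma sup_le_index (R : realType) (I : Type) (D : set I) (g : I -> R) (t : R) :
  D !=set0 -> (forall i, D i -> g i <= t) -> sup (g @` D) <= t.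
Proof.
by move=> [i Di] gt; apply: ge_sup; [exists (g i), i|move=> _ [j Dj <-]; exact: gt].
Qed.

Lemma le_sup_index (R : realType) (I : Type) (D : set I) (g : I -> R) (i : I) :
  has_ubound (g @` D) -> D i -> g i <= sup (g @` D).
Proof. by move=> ub Di; apply: ub_le_sup => //; exists i. Qed.

(* Infimum convolution on the cube with cost |x - y|^2 / 32: a linear form of
   coefficients [c] loses |c|^2 / (4 / 32) = 8 |c|^2, and the recursion on the
   dimension only uses this value, so that the infimum convolution itself never
   appears. *)
Lemma maurey (R : realType) (n : nat) (I : Type) (D : set I) (b : I -> R)
    (c : I -> 'I_n -> R) : D !=set0 ->
  (forall s, has_ubound [set b i + signed_sum (c i) s | i in D]) ->
  (\sum_s expR (sup [set b i + signed_sum (c i) s - 8 * \sum_j c i j ^+ 2 | i in D])) *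
  (\sum_s expR (- sup [set b i + signed_sum (c i) s | i in D])) <= 4 ^+ n.
Proof.
move=> D0; elim: n => [|n IH] in b c *; move=> ub.
  have e0 (G : {ffun 'I_0 -> bool} -> R) : \sum_s G s = G [ffun=> false].
    rewrite (bigD1 [ffun=> false])//= big1 ?addr0// => s /eqP; case.
    by apply/ffunP => -[].
  rewrite !e0 -expRD expr0 -expR0 ler_expR subr_le0.
  apply: sup_le_index => // i Di; rewrite big_ord0 mulr0 subr0.
  exact: (le_sup_index (ub [ffun=> false]) Di).
(* The offset [b] exists for the induction: on the face with first sign [e], the first coordinate is
   a constant for each index and is absorbed into it. *)
pose b' (e : bool) i := b i + (-1) ^+ e * c i ord0; pose c' i : 'I_n -> R := c i \o lift ord0.
have shift e s i : b i + signed_sum (c i) (ffun_cons (e, s)) =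
    b' e i + signed_sum (c' i) s by rewrite signed_sum_cons addrA.
pose Z e s := sup [set b' e i + signed_sum (c' i) s | i in D].
pose W e s := sup [set b' e i + signed_sum (c' i) s - 8 * \sum_j c' i j ^+ 2 | i in D].
have ub' e s : has_ubound [set b' e i + signed_sum (c' i) s | i in D].
  have [M ubM] := ub (ffun_cons (e, s)); exists M => _ [i Di <-].
  by apply: ubM; exists i => //; rewrite shift.
have ubW e s : has_ubound
    [set b' e i + signed_sum (c' i) s - 8 * \sum_j c' i j ^+ 2 | i in D].
  have [M ubM] := ub' e s; exists M => _ [i Di <-].
  apply: (@le_trans _ _ (b' e i + signed_sum (c' i) s)); last by apply: ubM; exists i.
  by rewrite gerBl mulr_ge0// sumr_ge0// => j _; exact: sqr_ge0.
have IHe e : (\sum_s expR (W e s)) * (\sum_s expR (- Z e s)) <= 4 ^+ n.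
  exact: IH.
rewrite !sum_ffun_cons.
pose V e s := sup [set b i + signed_sum (c i) (ffun_cons (e, s))
                       - 8 * \sum_j c i j ^+ 2 | i in D].
have ZE e : \sum_s expR (- sup [set b i + signed_sum (c i) (ffun_cons (e, s)) | i in D])
    = \sum_s expR (- Z e s).
  apply: eq_bigr => s _; congr (expR (- sup _)).
  by apply: eq_imagel => i _; rewrite shift.
rewrite (ZE false) (ZE true); change ((\sum_s expR (V false s) + \sum_s expR (V true s)) *
  (\sum_s expR (- Z false s) + \sum_s expR (- Z true s)) <= 4 ^+ n.+1).
(* Moving weight [theta] to the opposite face changes the linear term by [2 * theta * u] up to sign,
   with [u] the first coefficient. Completing the square pays for it with the penalty [8 * u ^+ 2]
   of that coordinate and [theta ^+ 2 / 8]. *)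
have VW e s theta : 0 <= theta -> theta <= 1 ->
    V e s <= theta ^+ 2 / 8 + ((1 - theta) * W e s + theta * W (~~ e) s).
  move=> t0 t1; apply: sup_le_index => // i Di.
  have h e' := le_sup_index (ubW e' s) Di.
  have : (1 - theta) * (b' e i + signed_sum (c' i) s - 8 * \sum_j c' i j ^+ 2) <=
     (1 - theta) * W e s by rewrite ler_wpM2l ?subr_ge0// h.
  have : theta * (b' (~~ e) i + signed_sum (c' i) s - 8 * \sum_j c' i j ^+ 2) <=
     theta * W (~~ e) s by rewrite ler_wpM2l// h.
  rewrite shift big_ord_recl -/(c' i).
  have -> : \sum_(j < n) c i (lift ord0 j) ^+ 2 = \sum_j c' i j ^+ 2 by [].
  rewrite /b'; set z := signed_sum _ _; set q := \sum_j _; set u := c i ord0.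
  have : 0 <= 8 * (u - (-1) ^+ e * theta / 8) ^+ 2 by rewrite mulr_ge0 ?sqr_ge0.
  by case: e {h} => /=; rewrite ?expr1 ?expr0; lra.
pose A e := \sum_s expR (W e s); pose F e := \sum_s expR (- Z e s).
have posF e : 0 < F e.
  rewrite /F (bigD1 [ffun=> false])//= ltr_pwDl ?expR_gt0//.
  by apply: sumr_ge0 => *; exact: expR_ge0.
have posA e : 0 < A e.
  rewrite /A (bigD1 [ffun=> false])//= ltr_pwDl ?expR_gt0//.
  by apply: sumr_ge0 => *; exact: expR_ge0.
have AF e : A e * F e <= 4 ^+ n by exact: IHe.
have GA e theta : 0 <= theta -> theta <= 1 -> \sum_s expR (V e s) <=
    expR (theta ^+ 2 / 8 + ((1 - theta) * ln (A e) + theta * ln (A (~~ e)))).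
  move=> t0 t1; rewrite expRD.
  apply: (@le_trans _ _ (expR (theta ^+ 2 / 8) *
      \sum_s expR ((1 - theta) * W e s + theta * W (~~ e) s))).
    rewrite mulr_sumr; apply: ler_sum => s _.
    by rewrite -expRD ler_expR VW.
  rewrite ler_wpM2l ?expR_ge0// hoelder_expR//.
  by apply/card_gt0P; exists [ffun=> false].
(* The face with the larger [F] takes [theta = 0], the other one the [theta] of [two_point]. As
   [A e' <= k / F e'], the product is at most [k * (1 + u) + k * (3 - u) = 4 * k]. *)
have key e : F (~~ e) <= F e ->
    (\sum_s expR (V e s) + \sum_s expR (V (~~ e) s)) * (F e + F (~~ e)) <= 4 ^+ n.+1.
  move=> Fle; set k : R := 4 ^+ n; have k0 : 0 < k by rewrite exprn_gt0.
  pose u := F (~~ e) / F e.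
  have u0 : 0 < u by rewrite divr_gt0.
  have u1 : u <= 1 by rewrite ler_pdivrMr// mul1r.
  have [theta [t0 t1 tu]] := two_point u0 u1.
  have Ge : \sum_s expR (V e s) <= k / F e.
    apply: le_trans (GA e 0 _ _) _ => //.
    by rewrite expr0n /= !mul0r subr0 mul1r addr0 add0r lnK ?posrE// ler_pdivlMr.
  have lnA e' : ln (A e') <= ln k - ln (F e').
    by rewrite -ln_div ?posrE// ler_ln ?posrE ?divr_gt0// ler_pdivlMr.
  have Gne : \sum_s expR (V (~~ e) s) <= k / F (~~ e) * expR (theta ^+ 2 / 8 + theta * ln u).
    apply: le_trans (GA (~~ e) theta _ _) _ => //; rewrite negbK.
    have -> : k / F (~~ e) = expR (ln k - ln (F (~~ e))).
      by rewrite -ln_div ?posrE// lnK ?posrE ?divr_gt0.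
    rewrite -expRD ler_expR ln_div ?posrE//.
    have := lnA e; have := lnA (~~ e); set x := ln _; set y := ln (F _).
    move=> /(ler_wpM2l (_ : 0 <= 1 - theta))-/(_ _)/wrap[]; first by rewrite subr_ge0.
    move=> h1 /(ler_wpM2l t0) h2; lra.
  have Fe : F (~~ e) = u * F e by rewrite /u divfK ?gt_eqF.
  apply: (@le_trans _ _ ((k / F e + k / F (~~ e) * expR (theta ^+ 2 / 8 + theta * ln u))
      * (F e + F (~~ e)))).
    by rewrite ler_wpM2r ?lerD// addr_ge0// ltW.
  rewrite Fe; set E := expR _ in tu *.
  have -> : (k / F e + k / (u * F e) * E) * (F e + u * F e) =
      k * (1 + u) + k / u * (E * (1 + u)).
    by field; rewrite !gt_eqF.
  have : k / u * (E * (1 + u)) <= k / u * (u * (3 - u)).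
    by rewrite ler_wpM2l// divr_ge0// ltW.
  have -> : k / u * (u * (3 - u)) = k * (3 - u) by field; rewrite gt_eqF.
  by rewrite exprS -/k; lra.
have [Fle|/ltW Fle] := leP (F true) (F false); first exact: (key false).
have := key true Fle.
by rewrite [X in X * _ <= _]addrC [X in _ * X <= _]addrC; apply.
Qed.

(** * Tail bounds, as counts of sign vectors *)

Lemma hoeffding_mgf (R : realType) (n : nat) (c : 'I_n -> R) :
  \sum_s expR (signed_sum c s) <= 2 ^+ n * expR ((\sum_i c i ^+ 2) / 2).
Proof.
elim: n => [|n IH] in c *.
  rewrite (bigD1 [ffun=> false])//= big1 ?addr0; last first.
    by move=> s /eqP; case; apply/ffunP => -[].
  by rewrite /signed_sum !big_ord0 mul0r mul1r.
rewrite sum_ffun_cons; under eq_bigr do rewrite signed_sum_cons expRD.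
under [X in _ + X]eq_bigr do rewrite signed_sum_cons expRD.
rewrite -!mulr_sumr -mulrDl expr0 mul1r expr1 mulN1r.
rewrite big_ord_recl [X in _ <= _ * expR X]mulrDl expRD exprS mulrACA.
apply: ler_pM; [by rewrite addr_ge0 ?expR_ge0| |exact: cosh_le|exact: IH].
by apply: sumr_ge0 => *; exact: expR_ge0.
Qed.

Lemma chernoff (R : realType) (T : finType) (g : T -> R) (v delta : R) :
  0 <= v -> 0 < delta < 1 ->
  (forall l, 0 < l ->
    \sum_s expR (l * g s) <= #|T|%:R * expR (l ^+ 2 * v / 2)) ->
  #|[pred s | Num.sqrt (2 * v * ln delta^-1) < g s]|%:R <= delta * #|T|%:R.
Proof.
move=> v0 /andP[d0 d1] mgf; set L := ln _; set t := Num.sqrt _.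
have L0 : 0 < L by rewrite /L ln_gt0// invf_gt1.
(* With [v = 0] the threshold is 0 and no [g s] can exceed it: for [l = #|T|%:R / g s] the single
   term at [s] would already be larger than [#|T|%:R]. *)
have [v_gt0|v_le0] := ltP 0 v; last first.
  have {v_le0 v0}vE : v = 0 by apply/eqP; rewrite eq_le v_le0.
  rewrite (_ : #|_| = 0%N) ?mulr_ge0 ?ler0n ?ltW//.
  apply: eq_card0 => s; apply/negbTE; rewrite inE -leNgt /t vE mulr0 mul0r sqrtr0.
  rewrite leNgt; apply/negP => gs.
  have lN : 0 < #|T|%:R / g s :> R.
    by rewrite divr_gt0// ltr0n; apply/card_gt0P; exists s.
  have := mgf _ lN; rewrite vE mulr0 mul0r expR0 mulr1 leNgt => /negP; apply.
  apply: (@lt_le_trans _ _ (expR (#|T|%:R / g s * g s))).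
    rewrite divfK ?gt_eqF//; apply: (lt_le_trans _ (expR_ge1Dx _)).
    by rewrite ltrDr.
  by rewrite (bigD1 s)//= lerDl sumr_ge0// => *; exact: expR_ge0.
have tE : t ^+ 2 = 2 * v * L by rewrite sqr_sqrtr// !mulr_ge0// ltW.
have t_gt0 : 0 < t by rewrite sqrtr_gt0 !mulr_gt0.
(* [t / v] minimizes [l ^+ 2 * v / 2 - l * t]. The right-hand exponent becomes [L], while each
   counted [s] contributes at least [expR (2 * L)]. *)
have := mgf (t / v) (divr_gt0 t_gt0 v_gt0).
have -> : (t / v) ^+ 2 * v / 2 = L.
  by rewrite exprMn tE; field; rewrite gt_eqF.
move=> h.
have {h} : #|[pred s | t < g s]|%:R * expR (2 * L) <= #|T|%:R * expR L.
  apply: le_trans h; rewrite -sum1_card natr_sum mulr_suml big_mkcond /=.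
  apply: ler_sum => s _; rewrite inE; case: ifPn => [ts|_]; last exact: expR_ge0.
  rewrite mul1r ler_expR (_ : 2 * L = t / v * t); last first.
    by rewrite mulrAC -expr2 tE; field; rewrite gt_eqF.
  by rewrite ler_wpM2l ?divr_ge0 ?ltW.
rewrite mulr2n mulrDl mul1r expRD mulrA ler_pM2r ?expR_gt0//.
rewrite /L lnK ?posrE ?invr_gt0// => h.
by rewrite mulrC -ler_pdivrMr.
Qed.

Lemma hoeffding (R : realType) (n : nat) (c : 'I_n -> R) (delta : R) :
  0 < delta < 1 ->
  #|[pred s | Num.sqrt (2 * (\sum_i c i ^+ 2) * ln delta^-1) < signed_sum c s]|%:R
  <= delta * #|{ffun 'I_n -> bool}|%:R.
Proof.
move=> d01; apply: chernoff => //; first by apply: sumr_ge0 => *; exact: sqr_ge0.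
move=> l _; rewrite card_ffun card_bool card_ord natrX mulr_sumr.
have := hoeffding_mgf (fun i => l * c i).
under [X in _ <= _ * expR (X / 2)]eq_bigr do rewrite exprMn.
congr (_ <= _); apply: eq_bigr => s _; congr expR.
by rewrite /signed_sum mulr_sumr; apply: eq_bigr => i _; rewrite mulrA.
Qed.

(** * Difference of the suprema at two independent sign vectors *)

Definition flip (n : nat) (s a : {ffun 'I_n -> bool}) : {ffun 'I_n -> bool} :=
  [ffun i => s i (+) a i].

Lemma sum_flip (R : realType) (n : nat) (G : {ffun 'I_n -> bool} -> R) a :
  \sum_s G (flip s a) = \sum_s G s.
Proof.
rewrite [RHS](reindex (fun s => flip s a))//.
have flipK : involutive ((@flip n)^~ a).
  by move=> s; apply/ffunP => i; rewrite !ffunE addbK.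
exact/onW_bij/inv_bij.
Qed.

Definition signed_sup (R : realType) (n : nat) (I : Type) (D : set I)
    (c : I -> 'I_n -> R) (s : {ffun 'I_n -> bool}) : R :=
  sup [set signed_sum (c i) s | i in D].

(** [maurey] applied to [l * c] with zero offset: the penalty is at most [8 * l ^+ 2 * v], so the
    difference is sub-Gaussian with variance proxy [16 * v], whence the 32. The translations by [a]
    and [b] preserve the uniform law. *)
Lemma sup_concentration (R : realType) (n : nat) (I : Type) (D : set I)
    (c : I -> 'I_n -> R) (v delta : R) (a b : {ffun 'I_n -> bool}) :
  D !=set0 -> (forall i, D i -> \sum_j c i j ^+ 2 <= v) -> 0 < delta < 1 ->
  #|[pred p : {ffun 'I_n -> bool} * {ffun 'I_n -> bool} |
      Num.sqrt (32 * v * ln delta^-1) <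
      signed_sup D c (flip p.1 a) - signed_sup D c (flip p.2 b)]|%:R
  <= delta * #|{: {ffun 'I_n -> bool} * {ffun 'I_n -> bool}}|%:R.
Proof.
move=> D0 cv d01; set Z := signed_sup D c.
have v0 : 0 <= v.
  by case: D0 => i /cv; apply: le_trans; apply: sumr_ge0 => *; exact: sqr_ge0.
have ub l s : has_ubound [set 0 + signed_sum (fun j => l * c i j) s | i in D].
  exists (\sum_(j < n) (l ^+ 2 * v + 1)) => _ [i Di <-].
  rewrite add0r; apply: ler_sum => j _.
  apply: (@le_trans _ _ ((l * c i j) ^+ 2 + 1)).
    set x := l * _; have := sqr_ge0 (x - 1); have := sqr_ge0 (x + 1).
    by case: (s j) => /=; rewrite ?expr0 ?expr1; nra.
  rewrite lerD2r exprMn ler_wpM2l ?sqr_ge0//; apply: le_trans (cv _ Di).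
  by rewrite (bigD1 j)//= lerDl sumr_ge0// => *; exact: sqr_ge0.
have ubZ s : has_ubound [set signed_sum (c i) s | i in D].
  have [M ubM] := ub 1 s; exists M => _ [i Di <-]; apply: ubM; exists i => //.
  by rewrite add0r; congr signed_sum; apply/funext => j; rewrite mul1r.
rewrite (_ : 32 * v = 2 * (16 * v)); last by ring.
apply: chernoff => //; first by rewrite mulr_ge0.
move=> l l0; rewrite -(pair_bigA _ (fun s s' =>
  expR (l * (Z (flip s a) - Z (flip s' b))))) /=.
under eq_bigr do under eq_bigr do rewrite mulrBr expRD.
under eq_bigr do rewrite -mulr_sumr.
rewrite -mulr_suml (sum_flip (fun s => expR (l * Z s)) a).
rewrite (sum_flip (fun s => expR (- (l * Z s))) b).
rewrite card_prod card_ffun card_bool card_ord -expnMn natrX.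
have scale i s : signed_sum (fun j => l * c i j) s = l * signed_sum (c i) s.
  by rewrite /signed_sum mulr_sumr; apply: eq_bigr => j _; rewrite mulrA.
rewrite -ler_pdivrMr ?expR_gt0// -expRN mulrAC mulr_suml.
apply: le_trans (maurey D0 (ub l)).
apply: ler_pM; [| |apply: ler_sum => s _..].
- by apply: sumr_ge0 => *; rewrite mulr_ge0 ?expR_ge0.
- by apply: sumr_ge0 => *; rewrite expR_ge0.
- rewrite -expRD ler_expR -lerBrDr -ler_pdivlMl//.
  apply: sup_le_index => // i Di; rewrite ler_pdivlMl// lerBrDr.
  apply: le_trans (le_sup_index _ Di); last first.
    have [M ubM] := ub l s; exists M => _ [k Dk <-].
    apply: (le_trans _ (ubM _ (ex_intro2 _ _ k Dk erefl))).
    by rewrite gerBl mulr_ge0// sumr_ge0// => *; exact: sqr_ge0.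
  rewrite add0r scale lerB//.
  under eq_bigr do rewrite exprMn; rewrite -mulr_sumr.
  have : l ^+ 2 * \sum_j c i j ^+ 2 <= l ^+ 2 * v by rewrite ler_wpM2l ?sqr_ge0 ?cv.
  lra.
- rewrite ler_expR lerN2; apply: sup_le_index => // i Di.
  by rewrite add0r scale ler_pM2l// (le_sup_index (ubZ s)).
Qed.

(** * Bregman losses *)

(** Second-order Taylor bound without a second derivative: the comparison function [f] has the
    nonnegative derivative [k * z - (dg z - dg 0)] for [0 <= z]. *)
Lemma derivative_growth (R : realType) (g dg : R -> R) (k : R) :
  (forall z : R, is_derive z 1 g (dg z)) ->
  (forall z, 0 <= z -> dg z - dg 0 <= k * z) -> g 1 <= g 0 + dg 0 + k / 2.
Proof.
move=> gE dg_le.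
pose f : R -> R := (k / 2) *: (id ^+ 2) - g + dg 0 *: id.
have df (z : R) : is_derive z 1 f (k * z - (dg z - dg 0)).
  apply: (is_derive_eq (is_deriveD (is_deriveB (is_deriveZ (k / 2)
    (is_deriveX 2 (is_derive_id z 1))) (gE z)) (is_deriveZ (dg 0) (is_derive_id z 1)))).
  by rewrite /GRing.scale /= expr1; field.
have := is_derive_ge0_le df _ ler01; rewrite /f !fctE /GRing.scale /=.
rewrite expr0n /= !mulr0 expr1n => /(_ _)/wrap[z z0|]; last by lra.
by rewrite subr_ge0 dg_le.
Qed.

Section Bregman.
Context {R : realType}.
Variables (phi : R -> R) (alpha beta : R).
Hypotheses (alpha_gt0 : 0 < alpha) (alpha_le_beta : alpha <= beta).
Hypothesis phi_derivable : forall t : R, derivable phi t 1.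
Hypothesis phi_convex : strongly_convex alpha phi.
Hypothesis phi_smooth : smooth beta phi.

Let beta_gt0 : 0 < beta := lt_le_trans alpha_gt0 alpha_le_beta.
Let alpha_ge0 : 0 <= alpha := ltW alpha_gt0.
Let beta_ge0 : 0 <= beta := ltW beta_gt0.

Lemma loss_ge s t : alpha / 2 * (s - t) ^+ 2 <= loss phi s t.
Proof. by rewrite /loss; have := phi_convex t s; lra. Qed.

Lemma loss_ge0 s t : 0 <= loss phi s t.
Proof.
by apply: le_trans (loss_ge _ _); rewrite mulr_ge0 ?sqr_ge0 ?divr_ge0 ?ltW.
Qed.

(** Descent lemma: [derivative_growth] along the segment from [t] to [s]. *)
Lemma loss_le s t : loss phi s t <= beta / 2 * (s - t) ^+ 2.
Proof.
set m := s - t.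
have dphi (z : R) : is_derive (t + m * z) 1 phi (derive1 phi (t + m * z)).
  by rewrite derive1E; exact/derivableP/phi_derivable.
have dq (z : R) : is_derive z 1 (fun z => t + m * z) m.
  apply: (is_derive_eq (is_deriveD (is_derive_cst t z 1) (is_deriveZ m (is_derive_id z 1)))).
  by rewrite add0r [LHS]mulr1.
have dg (z : R) : is_derive z 1 (phi \o (fun z => t + m * z)) (derive1 phi (t + m * z) * m).
  exact: (is_derive_eq (@is_derive1_comp R phi (fun z => t + m * z) z _ _ (dphi z) (dq z))).
have := derivative_growth (k := beta * m ^+ 2) dg.
rewrite /= mulr0 addr0 mulr1 /m subrKC -/m => /(_ _)/wrap[|h]; last first.
  by rewrite /loss -/m; lra.
move=> z z0; rewrite -mulrBl; apply: le_trans (ler_norm _) _; rewrite normrM.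
have := phi_smooth (t + m * z) t; rewrite addrAC subrr add0r normrM (ger0_norm z0).
move=> /(ler_wpM2r (normr_ge0 m)) h; apply: le_trans h _.
by rewrite -[m ^+ 2]real_normK ?num_real// le_eqVlt; apply/orP; left; apply/eqP; ring.
Qed.

(** Cocoercivity. A gradient step of length [1 / beta] from [s], for the loss with second argument
    [t], decreases this loss by at least [g ^+ 2 / (2 * beta)], and the loss stays nonnegative. *)
Lemma dloss_sqr_le s t : dloss phi s t ^+ 2 <= 2 * beta * loss phi s t.
Proof.
rewrite /dloss; set g := _ - _; pose x := s - g / beta.
have := loss_le x s; have := loss_ge0 x t.
have <- : loss phi x s + loss phi s t + g * (x - s) = loss phi x t.
  by rewrite /loss /g; ring.
have -> : x - s = - (g / beta) by rewrite /x; ring.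
rewrite sqrrN -(ler_pM2l (_ : 0 < 2 * beta)) ?mulr_gt0//.
rewrite -[_ <= beta / 2 * _](ler_pM2l (_ : 0 < 2 * beta)) ?mulr_gt0//.
have -> : 2 * beta * (beta / 2 * (g / beta) ^+ 2) = g ^+ 2.
  by field; rewrite gt_eqF.
have -> : 2 * beta * (loss phi x s + loss phi s t + g * - (g / beta)) =
  2 * beta * loss phi x s + 2 * beta * loss phi s t - 2 * g ^+ 2.
  by field; rewrite gt_eqF.
lra.
Qed.

Lemma dloss_monotone s t : alpha * (s - t) ^+ 2 <= dloss phi s t * (s - t).
Proof.
by rewrite /dloss; have := phi_convex s t; have := phi_convex t s; lra.
Qed.

Lemma dloss_sqr_ge s t : alpha ^+ 2 * (s - t) ^+ 2 <= dloss phi s t ^+ 2.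
Proof.
have := dloss_monotone s t; set g := dloss _ _ _; set m := s - t => h.
have [->|m0] := eqVneq m 0; first by rewrite expr0n /= mulr0 sqr_ge0.
rewrite -(ler_pM2r (_ : 0 < m ^+ 2)) ?exprn_even_gt0//.
have -> : alpha ^+ 2 * m ^+ 2 * m ^+ 2 = (alpha * m ^+ 2) ^+ 2 by ring.
have am0 : 0 <= alpha * m ^+ 2 by rewrite mulr_ge0 ?sqr_ge0 ?ltW.
by rewrite -exprMn ler_sqr ?nnegrE// (le_trans am0).
Qed.

Lemma continuous_derive1 : continuous (derive1 phi).
Proof.
move=> t; apply/cvgrPdist_lt => e e0; near=> z.
apply: le_lt_trans (phi_smooth _ _) _.
rewrite -ltr_pdivlMl//; near: z.
by apply: (@nbhsx_ballx _ R); rewrite mulr_gt0 ?invr_gt0.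
Unshelve. all: end_near. Qed.

(** Strong monotonicity forces the derivative past [v] at distance [p] on either side of 0; the
    intermediate value theorem does the rest. *)
Lemma derive1_surj (v : R) : exists t, derive1 phi t = v.
Proof.
pose p := `|v - derive1 phi 0| / alpha.
have p0 : 0 <= p by rewrite divr_ge0// ltW.
have pE : alpha * p = `|v - derive1 phi 0| by rewrite mulrC divfK ?gt_eqF.
have hi : v <= derive1 phi p.
  have [p_eq|p_gt] := eqVneq p 0.
    move: pE; rewrite p_eq mulr0 => /esym/eqP; rewrite normr_eq0 subr_eq0.
    by move=> /eqP ->.
  have := dloss_monotone p 0; rewrite /dloss subr0 expr2 mulrA ler_pM2r ?lt_def ?p_gt//.
  by rewrite pE; have := ler_norm (v - derive1 phi 0); lra.
have lo : derive1 phi (- p) <= v.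
  have [p_eq|p_gt] := eqVneq p 0.
    move: pE; rewrite p_eq mulr0 => /esym/eqP; rewrite normr_eq0 subr_eq0.
    by move=> /eqP ->; rewrite oppr0.
  have := dloss_monotone 0 (- p).
  rewrite /dloss sub0r opprK expr2 mulrA ler_pM2r ?lt_def ?p_gt//.
  by rewrite pE; have := ler_norm (- (v - derive1 phi 0)); rewrite normrN; lra.
have pp : - p <= p by lra.
have [t _ <-] := @IVT _ (derive1 phi) (- p) p v pp (continuous_subspaceT continuous_derive1)
  ltac:(by rewrite ge_min lo /= le_max hi orbT).
by exists t.
Qed.

(** * Empirical averages and the wild optimism *)

Section sample.
Variables (X : Type) (n : nat) (x : 'I_n -> X).
Hypothesis n_gt0 : (0 < n)%N.

Let nR_gt0 : 0 < n%:R :> R. Proof. by rewrite ltr0n. Qed.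

Lemma meanD (a b : 'I_n -> R) : mean (fun i => a i + b i) = mean a + mean b.
Proof. by rewrite /mean big_split mulrDr. Qed.

Lemma le_mean (a b : 'I_n -> R) : (forall i, a i <= b i) -> mean a <= mean b.
Proof. by move=> ab; rewrite /mean ler_wpM2l ?invr_ge0 ?ler0n// ler_sum. Qed.

Lemma mean_ge0 (a : 'I_n -> R) : (forall i, 0 <= a i) -> 0 <= mean a.
Proof. by move=> a0; rewrite /mean mulr_ge0 ?invr_ge0 ?ler0n// sumr_ge0. Qed.

Lemma Ln_ge0 (f g : X -> R) : 0 <= Ln phi x f g.
Proof. by apply: mean_ge0 => i; exact: loss_ge0. Qed.

Lemma sqrt_Ln_le (f g : X -> R) r : 0 <= r ->
  (Num.sqrt (Ln phi x f g) <= r) = (Ln phi x f g <= r ^+ 2).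
Proof.
by move=> r0; rewrite -[r in LHS]ger0_norm// -sqrtr_sqr ler_sqrt ?sqr_ge0.
Qed.

Lemma sum_dloss_sqr_le (f g : X -> R) :
  \sum_i dloss phi (f (x i)) (g (x i)) ^+ 2 <= 2 * beta * n%:R * Ln phi x f g.
Proof.
rewrite /Ln /mean -mulrA mulVKf ?gt_eqF// mulr_sumr.
by apply: ler_sum => i _; exact: dloss_sqr_le.
Qed.

(** Losses are compared with squared distances, [loss_le] on the left and [loss_ge] on the right;
    the factor 2 comes from the square of a sum. *)
Lemma Ln_quasi_triangle (f g h : X -> R) :
  Ln phi x g h <= 2 * (beta / alpha) * (Ln phi x f g + Ln phi x f h).
Proof.
rewrite -meanD /mean mulrCA ler_wpM2l ?invr_ge0 ?ler0n// mulr_sumr.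
apply: ler_sum => i _; apply: le_trans (loss_le _ _) _.
have := loss_ge (f (x i)) (g (x i)); have := loss_ge (f (x i)) (h (x i)).
set a := loss _ _ _; set b := loss _ _ _; set u := g _; set v := h _; set z := f _.
move=> ha hb.
have -> : 2 * (beta / alpha) * (b + a) = beta / 2 * (4 / alpha * (b + a)).
  by field; rewrite gt_eqF.
rewrite ler_wpM2l ?divr_ge0// mulrAC ler_pdivlMr//.
have : alpha * (u - v) ^+ 2 <= alpha * (2 * (z - u) ^+ 2 + 2 * (z - v) ^+ 2).
  by rewrite ler_wpM2l//; have := sqr_ge0 (u - z + v - z); nra.
nra.
Qed.

Lemma wild_responseE (fhat : X -> R) (y e : 'I_n -> R) rho i :
  derive1 phi (wild_response phi x fhat y e rho i) =
  derive1 phi (fhat (x i)) - rho * e i * (y i - fhat (x i)).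
Proof.
apply: (@xgetPex R 0 [set t : R |
  derive1 phi t = derive1 phi (fhat (x i)) - rho * e i * (y i - fhat (x i))]).
exact: derive1_surj.
Qed.

(** Up to [rho^-1], the summand is a product [(p - q) * (p - m)] of differences of derivatives at
    [fhat], [f] and [ydia]. Polarization writes it as half of the first two squares minus the third;
    [dloss_sqr_le] bounds the former, [dloss_sqr_ge] and [loss_le] the latter. Then [f] gives way to
    [fdia] in the first term by the ball condition, and in the negative one by minimality. *)
Lemma le_wild_optimism (fhat fdia f : X -> R) (y e : 'I_n -> R) (rho : R) :
  let ydia := wild_response phi x fhat y e rho in
  0 < rho ->
  Ln phi x fhat f <= Ln phi x fhat fdia ->
  mean (fun i => loss phi (ydia i) (fdia (x i))) <=
  mean (fun i => loss phi (ydia i) (f (x i))) ->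
  mean (fun i => dloss phi (fhat (x i)) (f (x i)) * e i * (y i - fhat (x i))) <=
  wild_optimism phi alpha beta rho x fhat fdia ydia.
Proof.
move=> ydia rho0; rewrite /Ln /mean !ler_pM2l ?invr_gt0// => ball opt.
have pt i : dloss phi (fhat (x i)) (f (x i)) * e i * (y i - fhat (x i)) <=
    beta / rho * loss phi (fhat (x i)) (f (x i))
    + beta / rho * loss phi (fhat (x i)) (ydia i)
    - alpha ^+ 2 / (beta * rho) * loss phi (ydia i) (f (x i)).
  have h1 := dloss_sqr_le (fhat (x i)) (f (x i)).
  have h2 := dloss_sqr_le (fhat (x i)) (ydia i).
  have h3 := dloss_sqr_ge (ydia i) (f (x i)).
  have h4 := loss_le (ydia i) (f (x i)).
  have yE := wild_responseE fhat y e rho i; rewrite -/ydia in yE.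
  have -> : dloss phi (fhat (x i)) (f (x i)) * e i * (y i - fhat (x i)) =
    rho^-1 * (dloss phi (fhat (x i)) (f (x i)) * dloss phi (fhat (x i)) (ydia i)).
    by rewrite /dloss yE; field; rewrite gt_eqF.
  set l1 := loss phi (fhat (x i)) (f (x i)) in h1 *.
  set l2 := loss phi (fhat (x i)) (ydia i) in h2 *.
  set l3 := loss phi (ydia i) (f (x i)) in h4 *.
  have -> : beta / rho * l1 + beta / rho * l2 - alpha ^+ 2 / (beta * rho) * l3 =
     rho^-1 * (beta * l1 + beta * l2 - alpha ^+ 2 / beta * l3).
    by field; rewrite !gt_eqF.
  have rho_ge0 := ltW rho0.
  rewrite ler_wpM2l ?invr_ge0//.
  have h5 : alpha ^+ 2 / beta * l3 <= alpha ^+ 2 / 2 * (ydia i - f (x i)) ^+ 2.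
    rewrite -mulrA [leRHS](_ : _ = alpha ^+ 2 * (beta^-1 *
      (beta / 2 * (ydia i - f (x i)) ^+ 2))); last by field; rewrite gt_eqF.
    by rewrite !ler_wpM2l ?invr_ge0 ?sqr_ge0.
  move: h1 h2 h3 h5; rewrite /dloss; set p := derive1 phi (fhat _).
  set q := derive1 phi (f _); set m := derive1 phi (ydia i).
  set l4 := alpha ^+ 2 / beta * l3; set l5 := _ - f _; set a2 := alpha ^+ 2.
  have -> : (m - q) ^+ 2 = (p - q) ^+ 2 + (p - m) ^+ 2 - 2 * ((p - q) * (p - m)) by ring.
  nra.
rewrite /wild_optimism.
set S1 := \sum_(i < n) loss phi (fhat _) (fdia _).
set S2 := \sum_(i < n) loss phi (fhat _) (ydia i).
set S3 := \sum_(i < n) loss phi (ydia i) (fdia _).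
have -> : beta / (rho * n%:R) * S1 + beta / (rho * n%:R) * S2
    - alpha ^+ 2 / (beta * rho * n%:R) * S3 =
    n%:R^-1 * (beta / rho * S1 + beta / rho * S2 - alpha ^+ 2 / (beta * rho) * S3).
  by field; rewrite !gt_eqF.
rewrite ler_pM2l ?invr_gt0//.
apply: le_trans (ler_sum _ (fun i _ => pt i)) _.
have rho_ge0 := ltW rho0.
rewrite sumrB big_split /= -!mulr_sumr lerB ?lerD//.
  by rewrite ler_wpM2l ?divr_ge0.
by rewrite ler_wpM2l ?divr_ge0 ?sqr_ge0 ?mulr_ge0.
Qed.

(** Three-point identity: the training error is [Ln phi x fstar fhat] plus the true optimism plus
    the average of [loss phi (y i) (fstar (x i))], which is nonnegative. *)
Lemma Ln_residual (fstar fhat : X -> R) (y : 'I_n -> R) :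
  Ln phi x fstar fhat <= mean (fun i => loss phi (y i) (fhat (x i)))
    + `|true_optimism phi x fstar fhat (fun i => y i - fstar (x i))|.
Proof.
apply: (@le_trans _ _ (mean (fun i => loss phi (y i) (fhat (x i)))
    - true_optimism phi x fstar fhat (fun i => y i - fstar (x i)))); last first.
  by rewrite lerD2l -normrN ler_norm.
rewrite -lerBDr opprK -meanD; apply: le_mean => i.
have := loss_ge0 (y i) (fstar (x i)); rewrite /loss /dloss; lra.
Qed.

Section training.
Variables (F : set (X -> R)) (C : set R) (A : ('I_n -> X * R) -> X -> R).
Hypothesis A_procedure : is_training_procedure phi x F C A.
Hypothesis feasible : exists f, F f /\ forall i, C (f (x i)).

(** A feasible competitor has a finite objective, so the minimizer cannot have an infinite
    penalty. *)
Lemma procedure_feasible z :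
  F (A (dataset x z)) /\ forall i, C (A (dataset x z) (x i)).
Proof.
have [FA opt] := A_procedure z; split => //.
have [f [Ff Cf]] := feasible; have := opt f Ff.
rewrite /objective /penalty (asboolT Cf) adde0.
by case: asboolP => // _; rewrite addey// leye_eq.
Qed.

Lemma procedure_minimal z f : F f -> (forall i, C (f (x i))) ->
  mean (fun i => loss phi (z i) (A (dataset x z) (x i))) <=
  mean (fun i => loss phi (z i) (f (x i))).
Proof.
move=> Ff Cf; have [_ CA] := procedure_feasible z.
have [_ /(_ f Ff)] := A_procedure z.
by rewrite /objective /penalty (asboolT Cf) (asboolT CA) !adde0 lee_fin.
Qed.

End training.
End sample.
End Bregman.

(** * Sign-invariant laws *)

Definition rectangles (R : realType) (K : finType) : set (set (K -> R)) :=
  [set [set z | forall k, B k (z k)] | B in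
    [set B : K -> set R | forall k, measurable (B k)]].

(** The product Borel structure on functions, generated by rectangles; a function type allows the
    index set ['I_n + 'I_n]. *)
Definition prodR (R : realType) (K : finType) :=
  g_sigma_algebraType (@rectangles R K).

Lemma measurable_prodRP d (T : measurableType d) (R : realType) (K : finType)
    (z : T -> prodR R K) :
  measurable_fun setT z <-> forall k, measurable_fun setT (fun t => z t k).
Proof.
split=> [mz k _ B mB|mz].
- rewrite setTI -[_ @^-1` _]/(z @^-1` [set u | B (u k)]) -[X in measurable X]setTI.
  apply: mz => //; apply: sub_sigma_algebra.
  exists (fun j => if j == k then B else setT) => [j|].
    by rewrite /=; case: eqP.
  apply/seteqP; split=> u /=; first by move=> /(_ k); rewrite eqxx.
  by move=> Bu j; case: eqP => // ->.
- apply: (measurability _ (erefl : @measurable _ (prodR R K) = <<s @rectangles R K >>)).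
  move=> _ [_ [B mB <-] <-]; rewrite setTI.
  have -> : z @^-1` [set u | forall k, B k (u k)] =
      \bigcap_(k in [set: K]) ((fun t => z t k) @^-1` B k).
    by apply/seteqP; split=> t /= Bt k; [move=> _|]; exact: Bt.
  apply: fin_bigcap_measurable; first exact: finite_finset.
  by move=> k _; rewrite -[X in measurable X]setTI; apply: mz.
Qed.

(** Rectangles are stable under intersection and generate the sigma-algebra, so two laws that agree
    on them coincide. *)
Lemma eq_prodR_law d (T : measurableType d) (R : realType) (P : probability T R)
    (K : finType) (z1 z2 : T -> prodR R K) :
  measurable_fun setT z1 -> measurable_fun setT z2 ->
  (forall B : K -> set R, (forall k, measurable (B k)) ->
     P [set t | forall k, B k (z1 t k)] = P [set t | forall k, B k (z2 t k)]) ->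
  forall E : set (prodR R K), measurable E -> P (z1 @^-1` E) = P (z2 @^-1` E).
Proof.
move=> m1 m2 eqP12 E mE.
pose X1 : {RV P >-> prodR R K} := MeasurableFun.Pack (MeasurableFun.Class
  (isMeasurableFun.Build _ _ _ _ z1 m1)).
pose X2 : {RV P >-> prodR R K} := MeasurableFun.Pack (MeasurableFun.Class
  (isMeasurableFun.Build _ _ _ _ z2 m2)).
have rT : @rectangles R K setT.
  by exists (fun _ => setT) => //; apply/seteqP; split.
apply: (@g_sigma_algebra_measure_unique _ _ (prodR R K) (@rectangles R K) _
  (fun _ => setT) _ _ (distribution P X1) (distribution P X2)) => //.
- by move=> A rA; exact: sub_sigma_algebra.
- by rewrite bigcup_const//; exists 0%N.
- move=> _ _ [B mB <-] [B' mB' <-]; exists (fun k => B k `&` B' k).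
    by move=> k; apply: measurableI.
  by apply/seteqP; split=> u /=; [move=> h; split=> k; have [] := h k|case=> h h' k].
- by move=> _ [B mB <-]; apply: eqP12.
- by move=> k; rewrite -ge0_fin_numE ?fin_num_measure.
Qed.

Definition flip_signs (R : realType) (K : Type) (s : K -> bool) (z : K -> R) : K -> R :=
  fun k => (-1) ^+ s k * z k.

Lemma measurable_flip_signs (R : realType) (K : finType) (s : K -> bool) :
  measurable_fun setT (flip_signs s : prodR R K -> prodR R K).
Proof.
apply/measurable_prodRP => k; apply: measurable_funM => //.
by move: k; apply/measurable_prodRP; exact: measurable_id.
Qed.

(** On rectangles independence turns both sides into products, whose factors agree by symmetry. *)
Lemma flip_signs_law d (T : measurableType d) (R : realType) (P : probability T R)
    (K : finType) (z : T -> prodR R K) (s : K -> bool) :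
  measurable_fun setT z ->
  (forall B : K -> set R, (forall k, measurable (B k)) ->
     (P [set t | forall k, B k (z t k)] = \prod_k P ((fun t => z t k) @^-1` B k))%E) ->
  (forall k, symmetric_law P (fun t => z t k)) ->
  forall E : set (prodR R K), measurable E ->
    P (z @^-1` E) = P ((fun t => flip_signs s (z t)) @^-1` E).
Proof.
move=> mz indep sym; apply: eq_prodR_law => //.
  by apply: (measurableT_comp (measurable_flip_signs s)).
move=> B mB.
pose B' k := (fun r : R => (-1) ^+ s k * r) @^-1` B k.
have mB' k : measurable (B' k).
  by rewrite -[X in measurable X]setTI; apply: measurable_funM.
rewrite (indep _ mB) (_ : [set t | _] = [set t | forall k, B' k (z t k)])//.
rewrite (indep _ mB'); apply: eq_bigr => k _; rewrite /B'; case: (s k) => /=.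
  by rewrite (sym k _ (mB k)); congr (P _); apply/funext => t /=; rewrite expr1 mulN1r.
by congr (P _); apply/funext => t /=; rewrite expr0 mul1r.
Qed.

(** All flipped events have the same probability, so [#|S|%:R] times it is the integral of the
    number of flips that send the point into [E]; this number is bounded pointwise. *)
Lemma flip_average d (T : measurableType d) (R : realType) (P : probability T R)
    (K S : finType) (z : T -> prodR R K) (sgn : S -> K -> bool)
    (E : set (prodR R K)) (delta : R) :
  measurable_fun setT z -> measurable E -> (0 < #|S|)%N ->
  (forall s, P (z @^-1` E) = P ((fun t => flip_signs (sgn s) (z t)) @^-1` E)) ->
  (forall u, #|[pred s | `[< E (flip_signs (sgn s) u) >]]|%:R <= delta * #|S|%:R) ->
  (P (z @^-1` E) <= delta%:E)%E.
Proof.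
move=> mz mE S0 inv count.
pose E' s := (fun t => flip_signs (sgn s) (z t)) @^-1` E.
have mE' s : measurable (E' s).
  rewrite /E' -[X in measurable X]setTI.
  by apply: (measurableT_comp (measurable_flip_signs (sgn s)) mz).
have SR0 : 0 < #|S|%:R :> R by rewrite ltr0n.
rewrite -(@lee_pmul2l _ #|S|%:R%:E)// -EFinM.
apply: (@le_trans _ _ (\sum_(s : S) P (E' s))%E).
  under eq_bigr do rewrite -inv.
  have fP : P (z @^-1` E) \is a fin_num.
    by apply: fin_num_measure; rewrite -[X in measurable X]setTI; exact: mz.
  by rewrite -(fineK fP) sumEFin sumr_const -EFinM mulr_natl.
have -> : (\sum_(s : S) P (E' s) = \int[P]_t \sum_(s : S) (\1_(E' s) t)%:E)%E.
  rewrite ge0_integral_sum//; last first.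
    by move=> s; apply/measurable_EFinP.
  by apply: eq_bigr => s _; rewrite integral_indic// setIT.
apply: (@le_trans _ _ (\int[P]_t (cst (delta * #|S|%:R)%:E) t)%E); last first.
  by rewrite integral_cst// [X in (_ * X)%E](probability_setT P) mule1 mulrC.
apply: ge0_le_integral => //.
- by move=> t _; apply: sume_ge0 => s _; rewrite lee_fin.
- by apply: emeasurable_sum => s; apply/measurable_EFinP.
- move=> t _ /=; rewrite sumEFin lee_fin; apply: le_trans (count (z t)).
  rewrite -sum1_card natr_sum [leRHS]big_mkcond /=.
  apply: ler_sum => s _; rewrite indicE inE.
  case: asboolP => [h|h]; first by rewrite ler_nat leq_b1.
  by rewrite memNset.
Qed.

(* A supremum of uncountably many linear forms exceeds [a] on a union of
   countably many rational boxes. *)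
Lemma measurable_sup_linear d (T : measurableType d) (R : realType) (n : nat)
    (I : Type) (D : set I) (c : I -> 'I_n -> R) (u : T -> 'I_n -> R) :
  D !=set0 ->
  (forall t, has_ubound [set \sum_j c i j * u t j | i in D]) ->
  (forall j, measurable_fun setT (fun t => u t j)) ->
  measurable_fun setT (fun t => sup [set \sum_j c i j * u t j | i in D]).
Proof.
move=> D0 ub mu mT; apply: (measurability _ (RGenOInfty.measurableE R)) => //.
move=> _ [_ [a ->] <-]; rewrite setTI preimage_itvoy.
pose U := [set v : 'I_n -> R | exists2 i, D i & a < \sum_j c i j * v j].
pose box (q : {ffun 'I_n -> rat * rat}) :=
  [set v : 'I_n -> R | forall j, ratr (q j).1 < v j < ratr (q j).2].
(* The preimage under a constant function is everything or empty: it selects the boxes contained in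
   [U] within a union over all rational boxes. *)
rewrite [X in measurable X](_ : _ = \bigcup_q
    ((fun=> `[< box q `<=` U >]) @^-1` [set true] `&` [set t | box q (u t)])).
  apply: countable_bigcupT_measurable; first exact: countableP.
  move=> q; apply: measurableI.
    rewrite -[X in measurable X]setTI.
    exact: (measurable_cst `[< box q `<=` U >]).
  rewrite (_ : [set t | _] = \bigcap_(j in [set: 'I_n])
      ((fun t => u t j) @^-1` `]ratr (q j).1, ratr (q j).2[)); last first.
    by apply/seteqP; split=> t /= qt j; [move=> _|]; have := qt j; rewrite /= in_itv; auto.
  apply: fin_bigcap_measurable; first exact: finite_finset.
  by move=> j _; rewrite -[X in measurable X]setTI; exact: mu.
apply/seteqP; split=> t /=; last first.
  case=> q _ [/asboolP qU /qU[i Di ai]].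
  by apply: lt_le_trans ai _; exact: (le_sup_index (ub t) Di).
move=> asup.
have [i Di ai] : U (u t).
  apply: contrapT => nU; move: asup; apply/negP; rewrite -leNgt.
  apply: sup_le_index => // i Di; rewrite leNgt; apply/negP => ai.
  by apply: nU; exists i.
pose gap := \sum_j c i j * u t j - a.
(* Perturbing each coordinate by at most [eta] moves the form of index [i] by less than [gap]; the
   added 1 keeps the inequality strict and the denominator positive. *)
pose eta := gap / (1 + \sum_j `|c i j|).
have den0 : 0 < 1 + \sum_j `|c i j| by rewrite ltr_pwDl ?sumr_ge0.
have gap0 : 0 < gap by rewrite subr_gt0.
have eta0 : 0 < eta by rewrite divr_gt0.
have /choice[q qP] : forall j, exists q : rat * rat,
    u t j - eta < ratr q.1 < u t j /\ u t j < ratr q.2 < u t j + eta.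
  move=> j; have [q1] := @rat_in_itvoo R (u t j - eta) (u t j) ltac:(lra).
  have [q2] := @rat_in_itvoo R (u t j) (u t j + eta) ltac:(lra).
  by rewrite !in_itv => h2 h1; exists (q1, q2).
exists [ffun j => q j] => //; split; last first.
  by move=> j; rewrite /= ffunE; have [/andP[_ ->] /andP[-> _]] := qP j.
apply/asboolP => v bv; exists i => //.
suff : `|\sum_j c i j * v j - \sum_j c i j * u t j| < gap.
  by rewrite ltr_norml /gap => /andP[]; lra.
rewrite -sumrB; apply: le_lt_trans (ler_norm_sum _ _ _) _.
apply: (@le_lt_trans _ _ (eta * \sum_j `|c i j|)).
  rewrite mulr_sumr; apply: ler_sum => j _.
  rewrite -mulrBr normrM mulrC ler_wpM2r// ler_norml.
  by have := bv j; rewrite ffunE; have [] := qP j; lra.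
by rewrite /eta mulrAC ltr_pdivrMr// ltr_pM2l// ltrDr.
Qed.

Lemma measurable_bigmax d (T : measurableType d) (R : realType) (I : Type)
    (s : seq I) (h : I -> T -> R) : (forall i, measurable_fun setT (h i)) ->
  measurable_fun setT (fun t => \big[Num.max/0]_(i <- s) h i t).
Proof.
move=> mh; elim: s => [|i s ih].
  by under eq_fun do rewrite big_nil; exact: measurable_cst.
under eq_fun do rewrite big_cons.
exact: measurable_maxr.
Qed.

(** * Deviation events under a sign-invariant law *)

Section sign_invariant_law.
Context d (T : measurableType d) (R : realType) (P : probability T R).
Variables (n : nat).
Local Notation U := (prodR R ('I_n + 'I_n)%type).
Variable z : T -> U.
Hypothesis mz : measurable_fun setT z.
Hypothesis z_flip : forall (s : 'I_n + 'I_n -> bool)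
  (E : set U), measurable E ->
  P (z @^-1` E) = P ((fun t => flip_signs s (z t)) @^-1` E).

Lemma measurable_coord (k : 'I_n + 'I_n) :
  measurable_fun setT (fun u : U => u k).
Proof. by move: k; apply/measurable_prodRP; exact: measurable_id. Qed.

(** The coefficients may depend on the point, as long as the flips only change their signs. The
    squares, hence the threshold, are then constant along each orbit, where [hoeffding] applies. *)
Lemma hoeffding_event (delta : R) (c : U -> 'I_n -> R)
    (sgn : {ffun 'I_n -> bool} -> 'I_n + 'I_n -> bool) :
  0 < delta < 1 -> (forall j, measurable_fun setT (fun u => c u j)) ->
  (forall u s j, c (flip_signs (sgn s) u) j = c u j * (-1) ^+ s j) ->
  let E := [set u | Num.sqrt (2 * (\sum_j c u j ^+ 2) * ln delta^-1)
                    < \sum_j c u j] in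
  measurable E /\ (P (z @^-1` E) <= delta%:E)%E.
Proof.
move=> d01 mc c_flip E.
have mE : measurable E.
  rewrite /E -[X in measurable X]setTI.
  apply: (@measurable_fun_ltr _ _ R setT _ _ _ _ measurableT [set true]) => //.
    apply: (@measurableT_comp _ _ _ _ _ _ (@Num.sqrt R)).
      by apply: continuous_measurable_fun; exact: sqrt_continuous.
    apply: measurable_funM => //; apply: measurable_funM => //.
    by apply: measurable_sum => j; apply: measurable_funX.
  exact: measurable_sum.
split=> //.
apply: (@flip_average _ _ _ _ _ _ z sgn) => //.
- by apply/card_gt0P; exists [ffun=> false].
- by move=> s; exact: z_flip.
- move=> u; apply: le_trans (hoeffding (c u) d01).
  rewrite ler_nat; apply: subset_leq_card; apply/fintype.subsetP => s.
  rewrite !inE /E /= /signed_sum.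
  under eq_bigr do rewrite c_flip exprMn sqrr_sign mulr1.
  by under [X in _ < X]eq_bigr do rewrite c_flip.
Qed.

Lemma sup_norm_ge (w : 'I_n -> R) j : `|w j| <= sup_norm w.
Proof. by rewrite /sup_norm (bigD1 j)//= le_max lexx. Qed.

Lemma sup_norm_ge0 (w : 'I_n -> R) : 0 <= sup_norm w.
Proof.
by rewrite /sup_norm; elim/big_ind: _ => // a b a0 b0; rewrite le_max a0.
Qed.

Lemma sum_weighted_sqr_le (w c : 'I_n -> R) :
  \sum_j (c j * w j) ^+ 2 <= sup_norm w ^+ 2 * \sum_j c j ^+ 2.
Proof.
rewrite mulr_sumr; apply: ler_sum => j _; rewrite exprMn mulrC.
rewrite ler_wpM2r ?sqr_ge0// -real_normK ?num_real//.
by rewrite ler_sqr ?nnegrE ?sup_norm_ge0 ?sup_norm_ge.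
Qed.

Definition linear_sup (I : Type) (D : set I) (c : I -> 'I_n -> R) (p : 'I_n -> R) : R :=
  sup [set \sum_j c i j * p j | i in D].

Section bounded_family.
Variables (I : Type) (D : set I) (c : I -> 'I_n -> R) (kappa : R).
Hypotheses (D0 : D !=set0) (c_le : forall i, D i -> \sum_j c i j ^+ 2 <= kappa).

Lemma has_ubound_linear p : has_ubound [set \sum_j c i j * p j | i in D].
Proof.
exists (kappa + \sum_j p j ^+ 2) => _ [i Di <-].
apply: (@le_trans _ _ (\sum_j c i j ^+ 2 + \sum_j p j ^+ 2)).
  rewrite -big_split; apply: ler_sum => j _ /=.
  have := sqr_ge0 (c i j - p j); have := sqr_ge0 (c i j); have := sqr_ge0 (p j); nra.
by rewrite lerD2r c_le.
Qed.

Lemma le_linear_sup p i : D i -> \sum_j c i j * p j <= linear_sup D c p.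
Proof. exact: le_sup_index (has_ubound_linear p). Qed.

(** The condition of modulus 1 is part of the event: flips preserve moduli, so orbits of other
    points never meet it, and on the remaining orbits the second block is a sign vector. *)
Lemma sup_event (delta : R) (b : bool) : 0 < delta < 1 ->
  let E := [set u : U | (forall j, `|u (inr j)| = 1) /\
    Num.sqrt (32 * (sup_norm (u \o inl) ^+ 2 * kappa) * ln delta^-1) <
    linear_sup D c (fun j => (-1) ^+ b * u (inl j))
    - linear_sup D c (fun j => u (inr j) * u (inl j))] in
  measurable E /\ (P (z @^-1` E) <= delta%:E)%E.
Proof.
move=> d01 E.
have mN : measurable_fun setT
    (fun u : U => sup_norm (u \o inl)).
  apply: measurable_bigmax => j.
  apply: measurableT_comp; first exact: normr_measurable.
  exact: (measurable_coord (inl j)).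
have mE : measurable E.
  rewrite /E (_ : [set u | _] =
    (\bigcap_(j in [set: 'I_n]) [set u : U | `|u (inr j)| == 1]) `&`
    [set u : U | Num.sqrt (32 * (sup_norm (u \o inl) ^+ 2 * kappa) * ln delta^-1) <
      linear_sup D c (fun j => (-1) ^+ b * u (inl j))
      - linear_sup D c (fun j => u (inr j) * u (inl j))]); last first.
    apply/seteqP; split=> u /= [h1 h2]; split=> // j; first by move=> _; apply/eqP.
    by apply/eqP; exact: h1.
  apply: measurableI.
    apply: fin_bigcap_measurable; first exact: finite_finset.
    move=> j _; rewrite -[X in measurable X]setTI.
    apply: (@measurable_fun_eqr _ _ R setT _ _ _ _ measurableT [set true]) => //.
    apply: measurableT_comp; first exact: normr_measurable.
    exact: (measurable_coord (inr j)).
  rewrite -[X in measurable X]setTI.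
  apply: (@measurable_fun_ltr _ _ R setT _ _ _ _ measurableT [set true]) => //.
    apply: (@measurableT_comp _ _ _ _ _ _ (@Num.sqrt R)).
      by apply: continuous_measurable_fun; exact: sqrt_continuous.
    apply: measurable_funM => //; apply: measurable_funM => //.
    by apply: measurable_funM => //; apply: measurable_funX.
  apply: measurable_funB; apply: measurable_sup_linear => // [u|j].
  - exact: has_ubound_linear.
  - by apply: measurable_funM => //; exact: (measurable_coord (inl j)).
  - exact: has_ubound_linear.
  - by apply: measurable_funM; [exact: (measurable_coord (inr j))|exact: (measurable_coord (inl j))].
split=> //.
(* Flipping the signs by [p.1] xor [p.2] makes the products of signs and noise flip by [p.2] alone,
   while the noise flips by [p.1]: the two suprema see independent flips. *)
pose sgn (p : {ffun 'I_n -> bool} * {ffun 'I_n -> bool}) (k : 'I_n + 'I_n) :=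
  match k with inl j => p.1 j | inr j => p.1 j (+) p.2 j end.
apply: (@flip_average _ _ _ _ _ _ z sgn) => //.
- by apply/card_gt0P; exists ([ffun=> false], [ffun=> false]).
- by move=> s; exact: z_flip.
move=> u.
have normE p j : `|flip_signs (sgn p) u (inr j)| = `|u (inr j)|.
  by rewrite /flip_signs normrM normrX normrN1 expr1n mul1r.
have [u1|/existsNP[j0 uj0]] := pselect (forall j, `|u (inr j)| = 1); last first.
  rewrite (_ : #|_| = 0%N) ?mulr_ge0 ?ler0n//; first by case/andP: d01 => /ltW.
  apply: eq_card0 => p; apply/negbTE; rewrite inE; apply/asboolP => -[h _].
  by apply: uj0; rewrite -(h j0) normE.
(* The sign pattern of the second block is one translation in [sup_concentration]; the constant
   pattern [b] is the other. *)
pose e : {ffun 'I_n -> bool} := [ffun j => u (inr j) < 0].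
have eE j : u (inr j) = (-1) ^+ e j.
  rewrite ffunE; have := u1 j; case: ltrP => h; first by rewrite ltr0_norm// => <-; rewrite opprK.
  by rewrite ger0_norm.
pose c' i j := c i j * u (inl j).
have c'_le i : D i -> \sum_j c' i j ^+ 2 <= sup_norm (u \o inl) ^+ 2 * kappa.
  move=> Di; apply: le_trans (sum_weighted_sqr_le (u \o inl) (c i)) _.
  by rewrite ler_wpM2l ?sqr_ge0 ?c_le.
apply: le_trans (sup_concentration [ffun=> b] e D0 c'_le d01).
rewrite ler_nat; apply: subset_leq_card; apply/fintype.subsetP => p.
rewrite !inE => -[_].
have -> : sup_norm (flip_signs (sgn p) u \o inl) = sup_norm (u \o inl).
  by apply: eq_bigr => j _; rewrite /= /flip_signs normrM normrX normrN1 expr1n mul1r.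
congr (is_true (_ < _ - _)); congr (sup _); apply: eq_imagel => i Di;
  rewrite /signed_sum; apply: eq_bigr => j _;
  rewrite /c' /flip_signs /= ?eE !ffunE !signr_addb.
  by rewrite mulrA -!mulrA; congr (_ * _); ring.
have := sqrr_sign R (p.1 j); rewrite expr2 => h.
move: ((-1) ^+ p.1 j) ((-1) ^+ p.2 j) ((-1) ^+ (u (inr j) < 0)%R) h => a a' a'' h.
transitivity ((a * a) * (c i j * u (inl j) * (a' * a''))); first by ring.
by rewrite h mul1r.
Qed.

End bounded_family.
End sign_invariant_law.

(** * Rademacher signs and the joint law of noise and signs *)

(** The two atoms already have total mass 1, so the complement of [D] is null. *)
Lemma rademacher_prob d (T : measurableType d) (R : realType) (P : probability T R)
    (e : {RV P >-> R}) (B : set R) : rademacher P e -> measurable B ->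
  P (e @^-1` B) = ((2^-1 * (1 \in B)%:R)%:E + (2^-1 * (-1 \in B)%:R)%:E)%E.
Proof.
move=> [P1 PN1] mB.
have mpre (A : set R) : measurable A -> measurable (e @^-1` A).
  by move=> mA; rewrite -[X in measurable X]setTI; exact: measurable_funP.
have m1 := mpre _ (measurable_set1 1); have mN1 := mpre _ (measurable_set1 (-1)).
have disj (A A' : set T) : (A `&` e @^-1` [set 1]) `&` (A' `&` e @^-1` [set -1]) = set0.
  apply/seteqP; split=> t //= [[_ e1] [_ eN1]].
  by have := e1; rewrite eN1; lra.
have addP (A A' : set T) : measurable A -> measurable A' -> A `&` A' = set0 ->
    P (A `|` A') = (P A + P A')%E by exact: measureU.
pose D := e @^-1` [set 1] `|` e @^-1` [set -1].
have mD : measurable D by exact: measurableU.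
have PD : P (~` D) = 0%E.
  rewrite probability_setC// /D addP//; last first.
    by have := disj setT setT; rewrite !setTI.
  rewrite P1 PN1 -EFinD (_ : 2^-1 + 2^-1 = 1 :> R); last by lra.
  by rewrite subrr.
rewrite -(setIT (e @^-1` B)) -(setUv D) setIUr addP; last 3 first.
- by apply: measurableI; [exact: mpre|].
- by apply: measurableI; [exact: mpre|exact: measurableC].
- by rewrite setIACA setICr setI0.
rewrite [X in (_ + X)%E](_ : _ = 0%E) ?adde0; last first.
  apply: (subset_measure0 _ _ _ PD).
  - by apply: measurableI; [exact: mpre|exact: measurableC].
  - exact: measurableC.
  - exact: subIsetr.
rewrite /D setIUr addP; last 3 first.
- by apply: measurableI; [exact: mpre|].
- by apply: measurableI; [exact: mpre|].
- exact: disj.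
have half (r : R) : P (e @^-1` [set r]) = (2^-1 : R)%:E ->
    P (e @^-1` B `&` e @^-1` [set r]) = (2^-1 * (r \in B)%:R)%:E.
  move=> Pr; have [rB|rB] := boolP (r \in B).
    rewrite mulr1 -Pr; congr (P _); apply/seteqP; split=> t /=; first by case.
    by move=> ->; split => //; rewrite inE in rB.
  rewrite mulr0 (_ : _ `&` _ = set0) ?measure0//.
  apply/seteqP; split=> t //= -[Bt er]; move: rB; rewrite notin_setE; apply.
  by rewrite -er.
by rewrite half// half.
Qed.

Lemma rademacher_symmetric d (T : measurableType d) (R : realType)
    (P : probability T R) (e : {RV P >-> R}) :
  rademacher P e -> symmetric_law P e.
Proof.
move=> re B mB; rewrite (rademacher_prob re mB).
pose B' := (fun r : R => - r) @^-1` B.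
have mB' : measurable B'.
  by rewrite -[X in measurable X]setTI; apply: (measurable_funN (@measurable_id _ _ setT)).
rewrite -[X in P X]/(e @^-1` B') (rademacher_prob re mB') addeC.
by congr (_%:E + _%:E)%E; congr (_ * _%:R); congr nat_of_bool;
  apply/idP/idP; rewrite !inE /B' /= ?opprK.
Qed.

Lemma measurable_norm_neq1 (R : realType) : measurable [set r : R | `|r| != 1].
Proof.
rewrite (_ : [set r | _] = ~` [set r | `|r| == 1]); last first.
  by apply/seteqP; split=> r /= /negP.
apply: measurableC; rewrite -[X in measurable X]setTI.
by apply: (@measurable_fun_eqr _ _ R setT _ _ _ _ measurableT [set true]).
Qed.

Lemma rademacher_norm d (T : measurableType d) (R : realType)
    (P : probability T R) (e : {RV P >-> R}) :
  rademacher P e -> P (e @^-1` [set r | `|r| != 1]) = 0%E.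
Proof.
move=> re; rewrite (rademacher_prob re); last exact: measurable_norm_neq1.
have -> : (1 \in [set r : R | `|r| != 1]) = false.
  by apply/negbTE; rewrite notin_setE /= normr1 eqxx.
have -> : (-1 \in [set r : R | `|r| != 1]) = false.
  by apply/negbTE; rewrite notin_setE /= normrN1 eqxx.
by rewrite !mulr0 adde0.
Qed.

Lemma mutually_independent_shift d (T : measurableType d) (R : realType)
    (P : probability T R) (n : nat) (y e : 'I_n -> {RV P >-> R}) (m : 'I_n -> R)
    (B : 'I_n + 'I_n -> set R) :
  mutually_independent (join_families y e) -> (forall k, measurable (B k)) ->
  let z t k := match k with inl i => y i t - m i | inr i => e i t end in
  P [set t | forall k, B k (z t k)] = (\prod_k P ((fun t => z t k) @^-1` B k))%E.
Proof.
move=> indep mB z.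
pose B' (k : 'I_n + 'I_n) :=
  match k with inl i => (fun r : R => r - m i) @^-1` B k | inr i => B k end.
have mB' k : measurable (B' k).
  case: k => i; rewrite /B' //.
  by rewrite -[X in measurable X]setTI; apply: measurable_funB.
have := indep [set: 'I_n + 'I_n]%SET _ mB'.
rewrite (_ : \bigcap_(k in _) _ = [set t | forall k, B k (z t k)]); last first.
  apply/seteqP; split=> t /=.
    by move=> h [i|i]; [have := h (inl i)|have := h (inr i)]; apply; rewrite /= inE.
  by move=> h [i|i] _; [exact: (h (inl i))|exact: (h (inr i))].
move=> ->; apply: eq_big => [k|k _]; first by rewrite inE.
by case: k.
Qed.

(** * Constants of the deviation term *)

(** The minimum is at most [alpha], hence at most [beta], and [Num.sqrt beta * beta] is the first
    entry of the maximum. *)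
Lemma sqrt_beta_le (R : realType) (alpha beta : R) :
  0 < alpha -> alpha <= beta ->
  Num.sqrt beta <= Num.max (beta `^ (3 / 2)) (beta ^+ 2) / Num.min (alpha `^ (3 / 2)) alpha.
Proof.
move=> a0 ab; have b0 : 0 < beta by exact: lt_le_trans ab.
have min0 : 0 < Num.min (alpha `^ (3 / 2)) alpha by rewrite lt_min powR_gt0// a0.
rewrite ler_pdivlMr//.
apply: (@le_trans _ _ (Num.sqrt beta * beta)).
  by rewrite ler_wpM2l ?sqrtr_ge0// ge_min ab orbT.
rewrite le_max; apply/orP; left; rewrite -(powR12_sqrt (ltW b0)).
rewrite -[X in _ * X](powRr1 (ltW b0)) -powRD; last by rewrite gt_eqF ?implybT.
by have -> : 2^-1 + 1 = 3 / 2 :> R by field.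
Qed.

(* The sub-Gaussian width of a Bregman ball of radius [q], in the form in which
   the theorem states it. *)
Lemma subgaussian_width_le (R : realType) (alpha beta L q N : R) (n : nat) :
  (0 < n)%N -> 0 < alpha -> alpha <= beta -> 0 <= L -> 0 <= q -> 0 <= N ->
  n%:R^-1 * Num.sqrt (2 * (N ^+ 2 * (2 * beta * n%:R * q ^+ 2)) * L) <=
  q * (2 * N * Num.max (beta `^ (3 / 2)) (beta ^+ 2) * Num.sqrt L
       / (Num.min (alpha `^ (3 / 2)) alpha * Num.sqrt n%:R)).
Proof.
move=> n0 a0 ab L0 q0 N0; have b0 : 0 < beta by exact: lt_le_trans ab.
have nR : 0 < n%:R :> R by rewrite ltr0n.
have sn : 0 < Num.sqrt n%:R :> R by rewrite sqrtr_gt0.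
rewrite (_ : _ * L = (2 * N * q) ^+ 2 * (beta * (n%:R * L))); last by ring.
rewrite sqrtrM ?sqr_ge0// sqrtr_sqr ger0_norm ?mulr_ge0//.
rewrite sqrtrM ?(ltW b0)// sqrtrM ?ler0n//.
rewrite -[X in X^-1 * _](sqr_sqrtr (ltW nR)).
set m := Num.min _ _; set M := Num.max _ _.
have min0 : 0 < m by rewrite lt_min powR_gt0// a0.
have := sqrt_beta_le a0 ab; rewrite -/m -/M => h.
have -> : q * (2 * N * M * Num.sqrt L / (m * Num.sqrt n%:R)) =
   (2 * N * q * Num.sqrt L / Num.sqrt n%:R) * (M / m).
  by field; rewrite !gt_eqF.
have -> : (Num.sqrt n%:R ^+ 2)^-1 * (2 * N * q * (Num.sqrt beta * (Num.sqrt n%:R * Num.sqrt L))) =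
   (2 * N * q * Num.sqrt L / Num.sqrt n%:R) * Num.sqrt beta.
  by field; rewrite gt_eqF.
by rewrite ler_wpM2l// divr_ge0 ?sqrtr_ge0// mulr_ge0 ?sqrtr_ge0// !mulr_ge0.
Qed.

(** * Excess risk as a Bregman distance *)

Lemma eq_law_expectation d d' (T : measurableType d) (T' : measurableType d')
    (R : realType) (P : probability T R) (P' : probability T' R)
    (y : {RV P >-> R}) (y' : {RV P' >-> R}) :
  (forall B, measurable B -> P (y @^-1` B) = P' (y' @^-1` B)) ->
  P.-integrable setT (EFin \o y) ->
  P'.-integrable setT (EFin \o y') /\ ('E_P'[y'] = 'E_P[y])%E.
Proof.
move=> law iy.
have eq_dist (f : R -> \bar R) :
    (\int[distribution P y]_x f x = \int[distribution P' y']_x f x)%E.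
  by apply: eq_measure_integral => B mB _; exact: law.
have iy' : P'.-integrable setT (EFin \o y').
  apply/integrableP; split; first exact/measurable_EFinP.
  have mf : measurable_fun setT (fun r : R => `|r%:E|%E).
    by apply: measurableT_comp => //; exact/measurable_EFinP.
  have := ge0_integral_distribution y' mf (fun _ => abse_ge0 _).
  rewrite -eq_dist (ge0_integral_distribution y mf (fun _ => abse_ge0 _)) => <-.
  by case/integrableP: iy.
split=> //; rewrite !expectation_def.
have mE : measurable_fun setT (@EFin R) by exact/measurable_EFinP.
rewrite -(integral_distribution (P := P) (X := y) mE iy).
by rewrite -(integral_distribution (P := P') (X := y') mE iy') eq_dist.
Qed.

Lemma expectation_affine d (T : measurableType d) (R : realType)
    (P : probability T R) (n : nat) (y : 'I_n -> {RV P >-> R}) (k m : 'I_n -> R) (c : R) :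
  (forall i, P.-integrable setT (EFin \o y i)) ->
  (forall i, 'E_P[y i] = (m i)%:E)%E ->
  ('E_P[(fun t => c + \sum_i k i * y i t)%R] = (c + \sum_i k i * m i)%:E)%E.
Proof.
move=> iy Ey.
have iky i : P.-integrable setT (fun t => (k i * y i t)%:E).
  by have := integrableZl measurableT (k i) (iy i); apply: eq_integrable.
rewrite unlock.
under eq_integral do rewrite EFinD.
rewrite integralD//=; last first.
- under eq_fun do rewrite -sumEFin; exact: integrable_sum.
- exact: finite_measure_integrable_cst.
under [X in (_ + X)%E]eq_integral do rewrite -sumEFin.
rewrite integral_sum// integral_cst// [X in (_ * X)%E](probability_setT P) mule1.
rewrite EFinD -sumEFin; congr (_ + _)%E; apply: eq_bigr => i _.
under eq_integral do rewrite EFinM.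
rewrite integralZl//; last exact: iy.
by rewrite EFinM -Ey unlock.
Qed.

(** The terms [phi (y' i)] cancel in the difference of losses, which is therefore affine in the
    fresh responses, with slopes [k]. Its expectation is its value at the means. *)
Lemma excess_riskE d d' (T : measurableType d) (T' : measurableType d')
    (R : realType) (P : probability T R) (P' : probability T' R)
    (X : Type) (n : nat) (phi : R -> R) (x : 'I_n -> X) (fstar f : X -> R)
    (y : 'I_n -> {RV P >-> R}) (y' : 'I_n -> {RV P' >-> R}) :
  (forall i B, measurable B -> P (y i @^-1` B) = P' (y' i @^-1` B)) ->
  (forall i, P.-integrable setT (EFin \o y i)) ->
  (forall i, 'E_P[y i] = (fstar (x i))%:E)%E ->
  excess_risk phi x y' fstar f = (Ln phi x fstar f)%:E.
Proof.
move=> law iy Ey.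
pose k i := n%:R^-1 * dloss phi (fstar (x i)) (f (x i)).
pose c := Ln phi x fstar f - \sum_i k i * fstar (x i).
rewrite /excess_risk (_ : (fun _ => _) = (fun t => c + \sum_i k i * y' i t)); last first.
  apply/funext => t; rewrite /c /Ln /mean -mulrBr -sumrB.
  rewrite -addrA [X in _ + X]addrC -sumrB mulr_sumr mulr_sumr -big_split /=.
  by apply: eq_bigr => i _; rewrite /k /loss /dloss; ring.
rewrite (@expectation_affine _ _ _ _ _ _ k (fun i => fstar (x i)) c).
- by rewrite /c subrK.
- by move=> i; have [] := eq_law_expectation (law i) (iy i).
- by move=> i; have [_ ->] := eq_law_expectation (law i) (iy i).
Qed.

(** * The optimism bound *)

(** The deterministic half of the argument, at a fixed realization: the probabilistic estimates
    enter as hypotheses, with [b] covering both signs of the noise. *)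
Lemma true_optimism_le (R : realType) (phi : R -> R) (alpha beta : R)
    (alpha_gt0 : 0 < alpha) (alpha_le_beta : alpha <= beta)
    (phi_derivable : forall t : R, derivable phi t 1)
    (phi_convex : strongly_convex alpha phi) (phi_smooth : smooth beta phi)
    (X : Type) (n : nat) (n_gt0 : (0 < n)%N) (x : 'I_n -> X)
    (F : set (X -> R)) (C : set R) (fstar fdag fhat fdia : X -> R)
    (y e : 'I_n -> R) (r rho delta : R) :
  let w i := y i - fstar (x i) in
  let ydia := wild_response phi x fhat y e rho in
  let D := [set f | (F f /\ forall i, C (f (x i))) /\ Ln phi x fdag f <= r ^+ 2] in
  let c f j := dloss phi (fdag (x j)) (f (x j)) in
  let kappa := 2 * beta * n%:R * r ^+ 2 in
  0 < delta < 1 ->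
  F fdag /\ (forall i, C (fdag (x i))) -> F fhat /\ (forall i, C (fhat (x i))) ->
  (forall f, F f -> (forall i, C (f (x i))) ->
     mean (fun i => loss phi (ydia i) (fdia (x i))) <=
     mean (fun i => loss phi (ydia i) (f (x i)))) ->
  Num.sqrt (Ln phi x fdag fhat) <= r -> 0 < rho ->
  Num.sqrt (Ln phi x fhat fdia) = 3 * Num.sqrt (beta / alpha) * r ->
  (forall i, `|e i| = 1) ->
  (forall b : bool,
     \sum_j (-1) ^+ b * dloss phi (fstar (x j)) (fdag (x j)) * w j <=
     Num.sqrt (2 * (\sum_j ((-1) ^+ b * dloss phi (fstar (x j)) (fdag (x j)) * w j) ^+ 2)
               * ln delta^-1)) ->
  \sum_j c fhat j * e j * w j <=
    Num.sqrt (2 * (\sum_j (c fhat j * e j * w j) ^+ 2) * ln delta^-1) ->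
  (forall b : bool,
     linear_sup D c (fun j => (-1) ^+ b * w j) - linear_sup D c (fun j => e j * w j) <=
     Num.sqrt (32 * (sup_norm w ^+ 2 * kappa) * ln delta^-1)) ->
  `|true_optimism phi x fstar fhat w| <=
    `|wild_optimism phi alpha beta rho x fhat fdia ydia|
    + pilot_error phi alpha beta r x F fstar fhat e
    + deviation phi alpha beta r delta x fstar fdag w.
Proof.
move=> w ydia D c kappa /andP[d0 d1] [Fdag Cdag] [Fhat Chat] opt.
set L := ln delta^-1 => hr rho0 hdia e1 h1 h2 h3.
have L0 : 0 <= L by rewrite ln_ge0// invf_ge1// ltW.
have r0 : 0 <= r by apply: le_trans hr; exact: sqrtr_ge0.
have b0 : 0 < beta by exact: lt_le_trans alpha_gt0 alpha_le_beta.
have nR : 0 < n%:R :> R by rewrite ltr0n.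
have nV : 0 <= n%:R^-1 :> R by rewrite invr_ge0 ltW.
have ba0 : 0 <= beta / alpha by rewrite divr_ge0// ltW.
pose N := sup_norm w; have N0 : 0 <= N by exact: sup_norm_ge0.
have Ln0 f g : 0 <= Ln phi x f g by exact: (Ln_ge0 alpha_gt0 phi_convex).
have sum_le f g : \sum_i dloss phi (f (x i)) (g (x i)) ^+ 2 <= 2 * beta * n%:R * Ln phi x f g.
  exact: (sum_dloss_sqr_le alpha_gt0 alpha_le_beta).
rewrite /deviation; set Dv := (X in _ + _ * X); set q0 := Num.sqrt (Ln phi x fstar fdag).
have width q S : 0 <= q -> S <= N ^+ 2 * (2 * beta * n%:R * q ^+ 2) ->
    n%:R^-1 * Num.sqrt (2 * S * L) <= q * Dv.
  move=> q_ge0 Sle.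
  apply: le_trans (subgaussian_width_le n_gt0 alpha_gt0 alpha_le_beta L0 q_ge0 N0).
  rewrite ler_wpM2l// ler_wsqrtr// ler_wpM2r// ler_wpM2l//.
have hat_le : Ln phi x fdag fhat <= r ^+ 2.
  by rewrite -sqrt_Ln_le.
have Dhat : D fhat by [].
have D0 : D !=set0 by exists fhat.
have c_le f : D f -> \sum_j c f j ^+ 2 <= kappa.
  move=> [_ fr]; apply: le_trans (sum_le _ _) _.
  by rewrite ler_wpM2l// !mulr_ge0 ?ler0n ?(ltW b0).
have H1 (b : bool) :
    n%:R^-1 * (\sum_j (-1) ^+ b * dloss phi (fstar (x j)) (fdag (x j)) * w j) <= q0 * Dv.
  apply: (le_trans (ler_wpM2l nV (h1 b))); apply: width; first exact: sqrtr_ge0.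
  apply: le_trans (sum_weighted_sqr_le _ _) _; rewrite ler_wpM2l ?sqr_ge0//.
  rewrite /q0 sqr_sqrtr//; apply: le_trans (sum_le fstar fdag).
  by apply: ler_sum => j _; rewrite exprMn sqrr_sign mul1r.
have H2 : n%:R^-1 * (\sum_j c fhat j * e j * w j) <= r * Dv.
  apply: (le_trans (ler_wpM2l nV h2)); apply: width => //.
  apply: le_trans (sum_weighted_sqr_le _ _) _; rewrite ler_wpM2l ?sqr_ge0//.
  apply: le_trans (c_le _ Dhat); apply: ler_sum => j _.
  by rewrite exprMn -(real_normK (num_real (e j))) e1 expr1n mulr1.
(* As 32 is 16 times the 2 of a Hoeffding term, this comparison costs four widths of radius [r]; the
   bounds on [c fhat] in [H2] supply the fifth. *)
have H3 (b : bool) : n%:R^-1 * linear_sup D c (fun j => (-1) ^+ b * w j) <=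
    n%:R^-1 * linear_sup D c (fun j => e j * w j) + 4 * (r * Dv).
  rewrite -lerBlDl -mulrBr; apply: (le_trans (ler_wpM2l nV (h3 b))).
  rewrite (_ : 32 * (sup_norm w ^+ 2 * kappa) * L =
    4 ^+ 2 * (2 * (sup_norm w ^+ 2 * kappa) * L)); last by ring.
  rewrite sqrtrM ?sqr_ge0// sqrtr_sqr ger0_norm// mulrCA ler_wpM2l//.
  exact: width.
have H4 : n%:R^-1 * linear_sup D c (fun j => e j * w j) <=
    r * Dv + (`|wild_optimism phi alpha beta rho x fhat fdia ydia|
    + pilot_error phi alpha beta r x F fstar fhat e).
  rewrite ler_pdivrMl//; apply: sup_le_index => // f Df.
  rewrite -ler_pdivrMl//.
  have [[Ff Cf] fr] := Df.
  have R2 : (3 * Num.sqrt (beta / alpha) * r) ^+ 2 = 9 * (beta / alpha) * r ^+ 2.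
    by rewrite !exprMn sqr_sqrtr//; ring.
  (* The quasi-triangle inequality through [fdag] gives [4 * (beta / alpha) * r ^+ 2], within the 9
     of the squared radius. *)
  have ball : Ln phi x fhat f <= (3 * Num.sqrt (beta / alpha) * r) ^+ 2.
    apply: (le_trans (Ln_quasi_triangle alpha_gt0 alpha_le_beta phi_derivable
      phi_convex phi_smooth x fdag fhat f)).
    rewrite R2.
    have : (beta / alpha) * (Ln phi x fdag fhat + Ln phi x fdag f) <=
      (beta / alpha) * (r ^+ 2 + r ^+ 2) by rewrite ler_wpM2l// lerD.
    have : 0 <= (beta / alpha) * r ^+ 2 by rewrite mulr_ge0 ?sqr_ge0.
    by move: (beta / alpha) => k; lra.
  have R0 : 0 <= 3 * Num.sqrt (beta / alpha) * r by rewrite !mulr_ge0 ?sqrtr_ge0.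
  have wild : mean (fun i => dloss phi (fhat (x i)) (f (x i)) * e i * (y i - fhat (x i)))
      <= wild_optimism phi alpha beta rho x fhat fdia ydia.
    apply: (le_wild_optimism alpha_gt0 alpha_le_beta phi_derivable) => //; last exact: opt.
    by rewrite -[leRHS]sqr_sqrtr// hdia.
  have pilot : mean (fun i => dloss phi (fhat (x i)) (f (x i)) * e i
      * (fhat (x i) - fstar (x i))) <= pilot_error phi alpha beta r x F fstar fhat e.
    apply: ub_le_sup; last first.
      exists f => //; split=> //.
      by rewrite mulrAC sqrt_Ln_le.
    (* Comparing with [sup] requires an upper bound of the set: each product is at most the sum of
       the squares of its factors, and the ball controls the first sum. *)
    exists (n%:R^-1 * (2 * beta * n%:R * (3 * Num.sqrt (beta / alpha) * r) ^+ 2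
      + \sum_i (e i * (fhat (x i) - fstar (x i))) ^+ 2)) => _ [g [_ gball] <-].
    rewrite /mean ler_wpM2l//.
    apply: (@le_trans _ _ (\sum_i (dloss phi (fhat (x i)) (g (x i)) ^+ 2 +
        (e i * (fhat (x i) - fstar (x i))) ^+ 2))).
      apply: ler_sum => i _; rewrite -mulrA.
      set p := dloss _ _ _; set p' := e i * _.
      by have := sqr_ge0 (p - p'); have := sqr_ge0 p; have := sqr_ge0 p'; nra.
    rewrite big_split /= lerD2r; apply: le_trans (sum_le _ _) _.
    rewrite ler_wpM2l ?mulr_ge0 ?(ltW b0)//.
    by rewrite -sqrt_Ln_le// mulrAC.
  have -> : n%:R^-1 * (\sum_j c f j * (e j * w j)) =
    n%:R^-1 * (\sum_j c fhat j * e j * w j) +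
    (mean (fun i => dloss phi (fhat (x i)) (f (x i)) * e i * (y i - fhat (x i))) +
     mean (fun i => dloss phi (fhat (x i)) (f (x i)) * e i * (fhat (x i) - fstar (x i)))).
    rewrite /mean -!mulrDr -!big_split; congr (_ * _); apply: eq_bigr => j _ /=.
    by rewrite /c /w /dloss; ring.
  apply: lerD => //; apply: lerD => //.
  by apply: le_trans wild _; exact: ler_norm.
have H5 (b : bool) : n%:R^-1 * \sum_j c fhat j * ((-1) ^+ b * w j) <=
    n%:R^-1 * linear_sup D c (fun j => (-1) ^+ b * w j).
  by rewrite ler_wpM2l//; apply: (le_linear_sup c_le).
have H (b : bool) : (-1) ^+ b * true_optimism phi x fstar fhat w <=
  `|wild_optimism phi alpha beta rho x fhat fdia ydia|
    + pilot_error phi alpha beta r x F fstar fhat e + (q0 + 5 * r) * Dv.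
  have -> : (-1) ^+ b * true_optimism phi x fstar fhat w =
    n%:R^-1 * (\sum_j (-1) ^+ b * dloss phi (fstar (x j)) (fdag (x j)) * w j) +
    n%:R^-1 * \sum_j c fhat j * ((-1) ^+ b * w j).
    rewrite /true_optimism /mean -mulrDr -big_split /= mulrCA mulr_sumr; congr (_ * _).
    apply: eq_bigr => j _ /=; move: ((-1) ^+ b) => s.
    by rewrite /c /dloss; ring.
  have := H1 b; have := H3 b; have := H5 b; have := H4; lra.
by rewrite ler_norml; apply/andP; split; [have := H true|have := H false];
  rewrite ?expr1 ?expr0; lra.
Qed.

Theorem theorem5p2 (R : realType)
  (* loss *)
  (phi : R -> R) (alpha beta : R)
  (alpha_gt0 : 0 < alpha) (alpha_le_beta : alpha <= beta)
  (phi_derivable : forall t : R, derivable phi t 1)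
  (phi_convex : strongly_convex alpha phi)
  (phi_smooth : smooth beta phi)
  (* design, function class and training procedure *)
  (X : Type) (n : nat) (n_gt0 : (0 < n)%N) (x : 'I_n -> X)
  (Y C : set R) (F : set (X -> R))
  (F_codomain : forall f, F f -> forall t : X, Y (f t))
  (C_compact : compact C)
  (feasible : exists f, F f /\ forall i, C (f (x i)))
  (A : ('I_n -> X * R) -> X -> R)
  (A_procedure : is_training_procedure phi x F C A)
  (A_measurable : measurable_procedure x A)
  (* conditional laws, training responses, regression function *)
  (law : X -> probability R R)
  (d : measure_display) (Omega : measurableType d) (P : probability Omega R)
  (y eps : 'I_n -> {RV P >-> R})
  (y_law : forall (i : 'I_n) (B : set R), measurable B ->
     P (y i @^-1` B) = law (x i) B)
  (y_integrable : forall i : 'I_n, P.-integrable setT (EFin \o y i))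
  (fstar : X -> R)
  (fstarE : forall i : 'I_n, ('E_P[y i] = (fstar (x i))%:E)%E)
  (w_symmetric : forall i : 'I_n,
     symmetric_law P (fun omega => y i omega - fstar (x i)))
  (eps_rademacher : forall i : 'I_n, rademacher P (eps i))
  (independence : mutually_independent (join_families y eps))
  (* fresh responses *)
  (d' : measure_display) (Omega' : measurableType d')
  (P' : probability Omega' R) (y' : 'I_n -> {RV P' >-> R})
  (y'_law : forall (i : 'I_n) (B : set R), measurable B ->
     P' (y' i @^-1` B) = law (x i) B)
  (y'_independent : mutually_independent y')
  (* radius and confidence level *)
  (r delta : R) (delta_gt0 : 0 < delta) (delta_lt1 : delta < 1) :
  let w omega i := y i omega - fstar (x i) in
  let fdag := A (dataset x (fun i => fstar (x i))) in
  let fhat omega := A (dataset x (fun i => y i omega)) in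
  let ydia rho omega :=
    wild_response phi x (fhat omega) (fun i => y i omega)
      (fun i => eps i omega) rho in
  let fdia rho omega := A (dataset x (ydia rho omega)) in
  let bound rho omega :=
    `|wild_optimism phi alpha beta rho x (fhat omega) (fdia rho omega)
        (ydia rho omega)|
    + pilot_error phi alpha beta r x F fstar (fhat omega)
        (fun i => eps i omega)
    + deviation phi alpha beta r delta x fstar fdag (w omega) in
  let admissible rho omega :=
    [/\ Num.sqrt (Ln phi x fdag (fhat omega)) <= r, 0 < rho &
        Num.sqrt (Ln phi x (fhat omega) (fdia rho omega))
          = 3 * Num.sqrt (beta / alpha) * r] in
  with_probability_at_least P (1 - 8 * delta)
    [set omega | forall rho : R, admissible rho omega ->
       `|true_optimism phi x fstar (fhat omega) (w omega)| <= bound rho omega]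
  /\
  with_probability_at_least P (1 - 8 * delta)
    [set omega | forall rho : R, admissible rho omega ->
       (excess_risk phi x y' fstar (fhat omega)
        <= (mean (fun i => loss phi (y i omega) (fhat omega (x i)))
            + bound rho omega)%:E)%E].
Proof.
move=> w fdag fhat ydia fdia bound admissible.
have d01 : 0 < delta < 1 by rewrite delta_gt0.
pose m i := fstar (x i).
(* Centring the responses makes every coordinate symmetric, so the joint law is invariant under all
   sign flips. *)
pose z (omega : Omega) : prodR R ('I_n + 'I_n)%type :=
  fun k => match k with inl i => y i omega - m i | inr i => eps i omega end.
have mz : measurable_fun setT z.
  by apply/measurable_prodRP => -[i|i] //=; apply: measurable_funB.
have z_flip (s : 'I_n + 'I_n -> bool) (E : set (prodR R ('I_n + 'I_n)%type)) :
    measurable E -> P (z @^-1` E) = P ((fun t => flip_signs s (z t)) @^-1` E).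
  apply: flip_signs_law => // [B mB|[i|i]].
  - exact: (mutually_independent_shift m independence mB).
  - exact: w_symmetric.
  - exact: rademacher_symmetric.
pose coordl (j : 'I_n) := measurable_coord (R := R) (inl j : 'I_n + 'I_n).
pose coordr (j : 'I_n) := measurable_coord (R := R) (inr j : 'I_n + 'I_n).
pose D := [set f | (F f /\ forall i, C (f (x i))) /\ Ln phi x fdag f <= r ^+ 2].
pose c f j := dloss phi (fdag (x j)) (f (x j)).
pose kappa := 2 * beta * n%:R * r ^+ 2.
have feas z' : F (A (dataset x z')) /\ forall i, C (A (dataset x z') (x i)).
  exact: (procedure_feasible A_procedure feasible).
have beta_gt0 : 0 < beta by exact: lt_le_trans alpha_gt0 alpha_le_beta.
have D0 : D !=set0.
  exists fdag; split; first exact: feas.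
  rewrite /Ln /mean big1 ?mulr0 ?sqr_ge0// => i _.
  by rewrite /loss !subrr mulr0 subrr.
have c_le f : D f -> \sum_j c f j ^+ 2 <= kappa.
  move=> [_ fr]; apply: le_trans (sum_dloss_sqr_le alpha_gt0 alpha_le_beta
    phi_derivable phi_convex phi_smooth x n_gt0 fdag f) _.
  by rewrite ler_wpM2l// !mulr_ge0 ?ler0n ?(ltW beta_gt0).
(* The fit as a function of the noise block only: flips of the sign block leave it unchanged, so the
   signs can be flipped with [c (fit u)] frozen. *)
pose fit (u : prodR R ('I_n + 'I_n)%type) := A (dataset x (fun i => u (inl i) + m i)).
have fitE omega : fit (z omega) = fhat omega.
  by rewrite /fit /fhat; congr (A (dataset x _)); apply/funext => i; rewrite /= subrK.
have mfit j : measurable_fun setT (fun u => fit u (x j)).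
  pose tup (u : prodR R ('I_n + 'I_n)%type) := [tuple u (inl i) + m i | i < n].
  have mtup : measurable_fun setT tup.
    apply/measurable_fun_tnthP => i.
    rewrite (_ : _ \o _ = fun u => u (inl i) + m i); last first.
      by apply/funext => u; rewrite /= tnth_mktuple.
    by apply: measurable_funD => //; exact: coordl.
  rewrite (_ : (fun u => _) = (fun v : n.-tuple R => A (dataset x (tnth v)) (x j)) \o tup).
    exact: measurableT_comp.
  apply/funext => u; rewrite /= /fit; congr (A (dataset x _) _).
  by apply/funext => i; rewrite tnth_mktuple.
have mderiv : measurable_fun setT (derive1 phi).
  by apply: continuous_measurable_fun;
    exact: (continuous_derive1 alpha_gt0 alpha_le_beta phi_smooth).
pose cl (b : bool) (u : prodR R ('I_n + 'I_n)%type) j :=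
  (-1) ^+ b * dloss phi (fstar (x j)) (fdag (x j)) * u (inl j).
pose cr (u : prodR R ('I_n + 'I_n)%type) j := c (fit u) j * u (inr j) * u (inl j).
pose sl (s : {ffun 'I_n -> bool}) (k : 'I_n + 'I_n) :=
  if k is inl j then s j else false.
pose sr (s : {ffun 'I_n -> bool}) (k : 'I_n + 'I_n) :=
  if k is inr j then s j else false.
have sumsq f g : \sum_i dloss phi (f (x i)) (g (x i)) ^+ 2 <= 2 * beta * n%:R * Ln phi x f g.
  exact: (sum_dloss_sqr_le alpha_gt0 alpha_le_beta).
have evl b : let E := [set u | Num.sqrt (2 * (\sum_j cl b u j ^+ 2) * ln delta^-1)
                    < \sum_j cl b u j] in
    measurable E /\ (P (z @^-1` E) <= delta%:E)%E.
  apply: (hoeffding_event (sgn := sl) mz z_flip d01) => [j|u s j].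
    by apply: measurable_funM => //; exact: coordl.
  by rewrite /cl /flip_signs /=; move: ((-1) ^+ b) ((-1) ^+ s j) => p q; ring.
have evr : let E := [set u | Num.sqrt (2 * (\sum_j cr u j ^+ 2) * ln delta^-1)
                    < \sum_j cr u j] in
    measurable E /\ (P (z @^-1` E) <= delta%:E)%E.
  apply: (hoeffding_event (sgn := sr) mz z_flip d01) => [j|u s j].
    apply: measurable_funM; last exact: coordl.
    apply: measurable_funM; last exact: coordr.
    apply: measurable_funB => //.
    exact: (measurableT_comp mderiv (mfit j)).
  have -> : cr (flip_signs (sr s) u) j =
      c (fit u) j * ((-1) ^+ s j * u (inr j)) * u (inl j).
    rewrite /cr /flip_signs /= mul1r; congr (c _ _ * _ * _).
    by rewrite /fit; congr (A (dataset x _)); apply/funext => i; rewrite /= mul1r.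
  by rewrite /cr; move: ((-1) ^+ s j) => q; ring.
have evs b := sup_event mz z_flip D0 c_le b d01.
pose null := \big[setU/set0]_(i < n) (eps i @^-1` [set r | `|r| != 1]).
have [mnull Pnull] : measurable null /\ (P null <= 0%:E)%E.
  rewrite /null; elim/big_ind: _ => [|S1 S2 [m1 P1] [m2 P2]|i _].
  - by rewrite measure0.
  - split; first exact: measurableU.
    by apply: le_trans (measureU2 P m1 m2) _; rewrite -(adde0 0%:E) leeD.
  - split; last by rewrite (rademacher_norm (eps_rademacher i)).
    rewrite -[X in measurable X]setTI; apply: measurable_funP => //.
    exact: measurable_norm_neq1.
have mpre E : measurable E -> measurable (z @^-1` E).
  by move=> mE; rewrite -[X in measurable X]setTI; exact: mz.
have union S1 S2 (p1 p2 : R) : measurable S1 /\ (P S1 <= p1%:E)%E ->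
    measurable S2 /\ (P S2 <= p2%:E)%E ->
    measurable (S1 `|` S2) /\ (P (S1 `|` S2) <= (p1 + p2)%:E)%E.
  move=> [m1 P1] [m2 P2]; split; first exact: measurableU.
  by apply: le_trans (measureU2 P m1 m2) _; rewrite EFinD leeD.
have pull E (p : R) : measurable E /\ (P (z @^-1` E) <= p%:E)%E ->
    measurable (z @^-1` E) /\ (P (z @^-1` E) <= p%:E)%E.
  by move=> [mE PE]; split=> //; exact: mpre.
(* One null event and five events of probability at most [delta]: one for [cr], two for [cl] and two
   for the suprema. The total [5 * delta] is below the allowed [8 * delta]. *)
have [mbad Pbad] := union _ _ _ _ (conj mnull Pnull)
  (union _ _ _ _ (pull _ _ evr) (union _ _ _ _
    (union _ _ _ _ (pull _ _ (evl false)) (pull _ _ (evl true)))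
    (union _ _ _ _ (pull _ _ (evs false)) (pull _ _ (evs true))))).
set bad := _ `|` _ in mbad Pbad.
have mgood : measurable (~` bad) by exact: measurableC.
have Pgood : ((1 - 8 * delta)%:E <= P (~` bad))%E.
  rewrite probability_setC// EFinB leeB//; apply: le_trans Pbad _.
  by rewrite lee_fin; lra.
have opt_le omega rho : (~` bad) omega -> admissible rho omega ->
    `|true_optimism phi x fstar (fhat omega) (w omega)| <= bound rho omega.
  move=> ngood [hr rho0 hdia].
  have e1 i : `|eps i omega| = 1.
    apply/eqP; apply: contrapT => /negP ei; apply: ngood; left.
    by rewrite /null (bigD1 i)//=; left.
  apply: (@true_optimism_le R phi alpha beta alpha_gt0 alpha_le_beta phi_derivable
    phi_convex phi_smooth X n n_gt0 x F C fstar fdag (fhat omega) (fdia rho omega)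
    (fun i => y i omega) (fun i => eps i omega)) => //.
  - exact: feas.
  - exact: feas.
  - by move=> f Ff Cf; exact: (procedure_minimal A_procedure feasible).
  - move=> b; rewrite leNgt; apply/negP => h; apply: ngood; right; right; left.
    by case: b h => h; [right|left]; exact: h.
  - rewrite leNgt; apply/negP => h; apply: ngood; right; left.
    by rewrite /= /cr fitE; exact: h.
  - move=> b; rewrite leNgt; apply/negP => h; apply: ngood; right; right; right.
    by case: b h => h; [right|left]; split.
(* The event [bad] does not involve [rho], so one good event serves every admissible [rho], even a
   random one, and both conclusions. *)
split; exists (~` bad); split=> // omega good rho adm; first exact: opt_le.
rewrite (@excess_riskE _ _ _ _ _ P P' _ _ _ _ _ _ y y')//; last first.
  by move=> i B mB; rewrite y_law// y'_law.
rewrite lee_fin; apply: le_trans (Ln_residual alpha_gt0 phi_convex x fstar (fhat omega) (fun i => y i omega)) _.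
by rewrite lerD2l; exact: opt_le.
Qed.
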